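(* Let $d\geq 2$. The locus $\mathscr{A}_d\subset\mathbb{C}^{d-1}$ of hyperbolic polynomials of degree $d$ is lower semi-computable.
   Context: $\mathscr{A}_d$ is the set of all $(a_0,a_1,\dots,a_{d-2})\in\mathbb{C}^{d-1}$ such that the polynomial $z^d+a_{d-2}z^{d-2}+\cdots+a_1z+a_0$ is hyperbolic. The Julia set $J$ of a polynomial $p$ of degree at least $2$ is the topological boundary of the set of points of $\mathbb{C}$ with bounded forward orbit under $p$. The polynomial $p$ is hyperbolic if it is uniformly expanding on its Julia set, i.e. there are constants $C>0$ and $\Lambda>1$ such that $|(p^n)'(z)|\geq C\Lambda^n$ for all $z\in J$ and all $n\in\mathbb{N}$, where $p^n$ is the $n$-th iterate. $\mathbb{C}^{d-1}$ is identified with $\mathbb{R}^{2(d-1)}$ and regarded as a computable metric space with its standard Euclidean metric and with ideal points $\mathbb{Q}^{2(d-1)}$. An ideal ball is an open ball $B(x,r)$ with $x$ an ideal point and $r=2^{-i}$ for some $i\in\mathbb{Z}$. An open set $D$ is lower semi-computable if there exists a Turing machine producing a sequence $\{(x_i,r_i)\}_{i\in\mathbb{N}}$ such that each $B(x_i,r_i)$ is an ideal ball and $D=\bigcup_{i=1}^\infty B(x_i,r_i)$. *)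

(* Defs.v *)
From HB Require Import structures.
From mathcomp Require Import all_boot all_order all_algebra.
From mathcomp Require Import complex.
From mathcomp Require Import boolp classical_sets reals topology normedtype.

Set Implicit Arguments.
Unset Strict Implicit.
Unset Printing Implicit Defensive.

Import Order.TTheory GRing.Theory Num.Theory.
Import numFieldNormedType.Exports.

Local Open Scope classical_set_scope.
Local Open Scope ring_scope.

(** * Turing machines *)

(* Deterministic machines with finitely many tapes, infinite in both
   directions.  The input/output alphabet is [bool]; a machine may use an
   additional finite working alphabet [W].  [None] is the blank. *)
Definition symbol (W : Type) := option (bool + W).

Variant move := MoveLeft | Stay | MoveRight.

(* [tape_left] lists the cells to the left of the head, nearest first;
   [tape_right] lists the scanned cell and those to its right.  Cells that
   are not listed are blank. *)
Record tape (W : Type) := Tape {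
  tape_left : seq (symbol W);
  tape_right : seq (symbol W) }.

Definition read W (t : tape W) : symbol W := head None (tape_right t).

Definition write W (s : symbol W) (t : tape W) : tape W :=
  Tape (tape_left t) (s :: behead (tape_right t)).

Definition shift W (m : move) (t : tape W) : tape W :=
  match m with
  | MoveLeft =>
      Tape (behead (tape_left t)) (head None (tape_left t) :: tape_right t)
  | Stay => t
  | MoveRight => Tape (read t :: tape_left t) (behead (tape_right t))
  end.

(* The machine halts when [tm_step] returns [None].  Tape [ord0] carries the
   input and the output. *)
Record turing_machine := TuringMachine {
  tm_state : finType;
  tm_work : finType;
  tm_tapes : nat;
  tm_start : tm_state;
  tm_step : tm_state -> {ffun 'I_tm_tapes.+1 -> symbol tm_work} ->
    option (tm_state * ('I_tm_tapes.+1 -> symbol tm_work * move)) }.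

Section Run.
Variable M : turing_machine.

Record config := Config {
  cfg_state : tm_state M;
  cfg_tape : 'I_(tm_tapes M).+1 -> tape (tm_work M) }.

Definition step (c : config) : option config :=
  omap
    (fun r : tm_state M * ('I_(tm_tapes M).+1 -> symbol (tm_work M) * move) =>
       Config r.1 (fun k => shift (r.2 k).2 (write (r.2 k).1 (cfg_tape c k))))
    (tm_step (cfg_state c) [ffun k => read (cfg_tape c k)]).

Fixpoint run (n : nat) (c : config) : option config :=
  if n is n'.+1 then obind (run n') (step c) else Some c.

Definition symbols (w : seq bool) : seq (symbol (tm_work M)) :=
  [seq Some (inl b) | b <- w].

Definition init (w : seq bool) : config :=
  Config (tm_start M)
    (fun k => Tape [::] (if k == ord0 then symbols w else [::])).

(* The output is the word that starts at the head and ends before the first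
   blank. *)
Definition outputs (c : config) (w : seq bool) : Prop :=
  let s := tape_right (cfg_tape c ord0) in
  take (find (fun a => ~~ isSome a) s) s = symbols w.

Definition tm_computes (u v : seq bool) : Prop :=
  exists (n : nat) (c : config),
    [/\ run n (init u) = Some c, step c = None & outputs c v].

End Run.

(** * Words naming numbers, rational points and ideal balls *)

(* Self-delimiting unary: n is written 1^n 0. *)
Definition nat_word (n : nat) : seq bool := rcons (nseq n true) false.

(* A sign bit, then the absolute value. *)
Definition int_word (z : int) : seq bool := (z < 0) :: nat_word `|z|%N.

(* Numerator and denominator in lowest terms. *)
Definition rat_word (q : rat) : seq bool :=
  int_word (numq q) ++ int_word (denq q).

Definition ball_word m (x : 'rV[rat]_m) (i : int) : seq bool :=
  flatten [seq rat_word (x 0 j) | j <- enum 'I_m] ++ int_word i.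

(** * Lower semi-computable subsets of R^m *)

Definition euclidean_dist (R : realType) m (x y : 'rV[R]_m) : R :=
  Num.sqrt (\sum_(j < m) (x 0 j - y 0 j) ^+ 2).

Definition ideal_point (R : realType) m (x : 'rV[rat]_m) : 'rV[R]_m :=
  map_mx ratr x.

Definition ideal_ball (R : realType) m (x : 'rV[rat]_m) (i : int) :
    set 'rV[R]_m :=
  [set y | euclidean_dist (ideal_point R x) y < 2 ^ (- i)].

(* The machine produces the sequence of ideal balls B(x n, 2^-(e n)): on
   input n it halts with the name of the n-th ball.  Such a D is open, being a
   union of open balls. *)
Definition lower_semicomputable (R : realType) m (D : set 'rV[R]_m) : Prop :=
  exists (M : turing_machine) (x : nat -> 'rV[rat]_m) (e : nat -> int),
    (forall n, tm_computes M (nat_word n) (ball_word (x n) (e n))) /\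
    D = \bigcup_n ideal_ball (x n) (e n).

(** * Hyperbolic polynomials *)

Section Hyperbolic.
Variable R : realType.
Local Notation C := R[i].

Definition iterate (p : {poly C}) (n : nat) : {poly C} :=
  iter n (fun q => p \Po q) 'X.

Definition filled_julia (p : {poly C}) : set C^o :=
  [set z | exists B : R, forall n, `|(iterate p n).[z]| <= B%:C%C].

Definition julia (p : {poly C}) : set C^o :=
  closure (filled_julia p) `\` interior (filled_julia p).

Definition hyperbolic (p : {poly C}) : Prop :=
  exists c L : R, [/\ 0 < c, 1 < L &
    forall z, julia p z ->
      forall n, (c * L ^+ n)%:C%C <= `|((iterate p n)^`()).[z]|].

(* z^d + a_{d-2} z^{d-2} + ... + a_1 z + a_0 *)
Definition centered_poly (d : nat) (a : 'rV[C]_d.-1) : {poly C} :=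
  'X^d + \sum_(j < d.-1) a 0 j *: 'X^j.

Definition hyperbolic_locus (d : nat) : set 'rV[C]_d.-1 :=
  [set a | hyperbolic (centered_poly a)].

(* The identification of C^n with R^(2n): real parts first. *)
Definition realify n (a : 'rV[C]_n) : 'rV[R]_(n + n) :=
  row_mx (map_mx (@complex.Re R) a) (map_mx (@complex.Im R) a).

End Hyperbolic.

Arguments hyperbolic_locus : clear implicits.

(* Main.v *)
From HB Require Import structures.
From mathcomp Require Import all_boot all_order all_algebra.
From mathcomp Require Import complex.
From mathcomp Require Import boolp classical_sets reals topology normedtype.
From mathcomp Require Import zify ring lra.
Require Import Defs.

(** Hyperbolicity of a polynomial has finite certificates that can be checked
with rational arithmetic, so a machine that enumerates all of them lists balls
that exhaust the hyperbolic locus.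

A certificate lives on the grid of mesh 1/N in a square that contains the
filled Julia set. It gives each grid point a rank and a weight ([certificate]).
Rank at least 2 claims that nearby orbits leave the square, the rank dropping
at every step; rank 1 claims that they remain near points of rank 1; between
points of rank 0 the derivative must expand the metric whose density is the
weight. All inequalities have a margin of order 1/N, which absorbs the distance
from a point to the grid as well as the variation of the coefficients in a ball
of radius comparable with 1/N.

A certificate implies hyperbolicity of the whole ball
([certificate_hyperbolic]). Orbits that meet a cell of rank at least 2 are
unbounded. The union of the discs of radius 3/N about the points of rank 1 is
bounded and invariant, and it is a neighbourhood of their cells of radius 2/N,
which therefore lie in the interior of the filled Julia set. So the Julia set
meets only cells of rank 0, and along its orbits the derivatives multiply up to
at least (1 + 1/B)^n / B, where B bounds the densities.

Conversely, let p be hyperbolic, with |(p^n)'| >= 2 on the Julia set J. The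
density rho, the sum of |(p^k)'| over k < n, satisfies
|p'(z)| rho(p(z)) >= rho(z) + 1 on J ([density_expanding]): in the metric
rho |dz|, already p itself expands. Three facts follow. The inequality persists
near J ([density_expanding_near]). The points with bounded orbit at a
rho-distance at least e from J are mapped well inside the set of such points
([trap_invariant]): J is completely invariant, and a point whose image is close
to w in J is close to a preimage of w ([monic_preimage]), from where the
distance to J is expanded. By compactness, the points with unbounded orbit at
some distance from J escape after a bounded number of steps
([uniform_escape]). These sets provide ranks and weights on every sufficiently
fine grid ([hyperbolic_certificate]).

For the machine, programs with loops over stacks of bits are simulated by
Turing machines ([exec_simulation]), and the functions that such programs
compute are closed under primitive recursion ([computable_rec]). Thus it is
decidable whether n codes a certificate ([decidable_code_check]); on input n
the machine prints the ball of the certificate, or a fixed ball of the locus if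
n codes none. Numerators of the centres are odd and denominators are powers of
two, so the printed fractions are in lowest terms. *)

Set Implicit Arguments.
Unset Strict Implicit.
Unset Printing Implicit Defensive.

(** * Programs over stacks of bits and their simulation by Turing machines *)

(** Registers are stacks of bits; [While r P] runs [P] as long as the top of
register [r] is [true]. Numbers are kept in unary, so that such a loop can count
down. *)
Inductive program :=
  | Skip
  | Push of nat & bool
  | Pop of nat
  | Seq of program & program
  | While of nat & program.

Definition store := nat -> seq bool.

Definition upd (s : store) (r : nat) (w : seq bool) : store :=
  fun i => if i == r then w else s i.

Inductive exec : program -> store -> store -> Prop :=
  | ExecSkip s : exec Skip s s
  | ExecPush r b s : exec (Push r b) s (upd s r (b :: s r))
  | ExecPop r s : exec (Pop r) s (upd s r (behead (s r)))
  | ExecSeq P Q s1 s2 s3 :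
      exec P s1 s2 -> exec Q s2 s3 -> exec (Seq P Q) s1 s3
  | ExecDone r P s : head false (s r) = false -> exec (While r P) s s
  | ExecLoop r P s1 s2 s3 :
      head false (s1 r) -> exec P s1 s2 -> exec (While r P) s2 s3 ->
      exec (While r P) s1 s3.

Fixpoint max_reg (P : program) : nat :=
  match P with
  | Skip => 0
  | Push r _ | Pop r => r
  | Seq P Q => maxn (max_reg P) (max_reg Q)
  | While r P => maxn r (max_reg P)
  end.

(** One instruction is one step of the machine. [Branch r l] jumps to [l] unless
the head of tape [r] scans [true]. *)
Variant instr :=
  | MoveHead of nat & move
  | Put of nat & bool
  | Branch of nat & nat
  | Goto of nat.

Fixpoint compile (o : nat) (P : program) : seq instr :=
  match P with
  | Skip => [::]
  | Push r b => [:: MoveHead r MoveLeft; Put r b]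
  | Pop r => [:: MoveHead r MoveRight]
  | Seq P Q => let c := compile o P in c ++ compile (o + size c) Q
  | While r P =>
      let c := compile o.+1 P in
      Branch r (o + size c).+2 :: rcons c (Goto o)
  end.

Definition next_pc (i : instr) (pc : nat) (f : nat -> symbol void) : nat :=
  match i with
  | Goto l => l
  | Branch r l => if f r is Some (inl true) then pc.+1 else l
  | _ => pc.+1
  end.

Definition action (i : instr) (k : nat) (a : symbol void) :
    symbol void * move :=
  match i with
  | MoveHead r m => (a, if k == r then m else Stay)
  | Put r b => (if k == r then Some (inl b) else a, Stay)
  | _ => (a, Stay)
  end.

Definition machine (code : seq instr) (K : nat) : turing_machine :=
  @TuringMachine 'I_(size code).+1 void K ord0
    (fun q f =>
       if q < size code then
         let i := nth (Goto 0) code q in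
         Some (inord (next_pc i q (fun r => f (inord r))),
               fun k : 'I_K.+1 => action i k (f k))
       else None).

(** Register contents start under the head. Blanks behind them are explicit as
soon as the head has visited them, and what lies to the left is garbage. *)
Definition tape_holds (t : tape void) (w : seq bool) : Prop :=
  exists j, tape_right t = [seq Some (inl b) | b <- w] ++ nseq j None.

Lemma tape_holds_read t w : tape_holds t w ->
  read t = if w is b :: _ then Some (inl b) else None.
Proof. by case=> j; rewrite /read => ->; case: w => //=; case: j. Qed.

Lemma tape_holds_idle t w : tape_holds t w -> tape_holds (shift Stay (write (read t) t)) w.
Proof.
case=> j; rewrite /tape_holds /read /=; case: (tape_right t) => [|a r] /= E.
  by case: w E => //= _; exists 1.
by exists j.
Qed.

Lemma tape_holds_pop t w :
  tape_holds t w -> tape_holds (shift MoveRight (write (read t) t)) (behead w).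
Proof.
case=> j E; rewrite /tape_holds /= E; case: w {E} => [|b w] /=; last by exists j.
by case: j => [|j]; [exists 0 | exists j].
Qed.

Lemma tape_holds_push t w b : tape_holds t w ->
  tape_holds (write (Some (inl b)) (shift MoveLeft (write (read t) t))) (b :: w).
Proof.
case=> j E; rewrite /tape_holds /read /= E; case: w {E} => [|a w] /=.
  by case: j => [|j] /=; [exists 1 | exists j.+1].
by exists j.
Qed.

Section Simulation.
Variables (code : seq instr) (K : nat).
Let M := machine code K.

Definition represents (c : config M) (pc : nat) (s : store) : Prop :=
  (cfg_state c : 'I_(size code).+1) = pc :> nat /\
  forall k : 'I_K.+1, tape_holds (cfg_tape c k) (s k).

Definition reaches (c c' : config M) : Prop := exists n, run n c = Some c'.

Lemma reaches_refl c : reaches c c. Proof. by exists 0. Qed.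

Lemma reaches_trans c1 c2 c3 : reaches c1 c2 -> reaches c2 c3 -> reaches c1 c3.
Proof.
case=> n; elim: n c1 => [|n IH] c1 /=; first by case=> ->.
case E: (step c1) => [c|//] /= /IH H /H [m Hm]; exists m.+1.
by rewrite /= E.
Qed.

Lemma reaches_step c c' : step c = Some c' -> reaches c c'.
Proof. by move=> E; exists 1; rewrite /= E. Qed.

Lemma step_machine (c : config M) (pc : nat) (i : instr) :
  (cfg_state c : 'I_(size code).+1) = pc :> nat ->
  pc < size code -> nth (Goto 0) code pc = i ->
  step c = Some (@Config M
    (inord (next_pc i pc (fun r => read (cfg_tape c (inord r)))) :
       'I_(size code).+1)
    (fun k : 'I_K.+1 => shift (action i k (read (cfg_tape c k))).2
       (write (action i k (read (cfg_tape c k))).1 (cfg_tape c k)))).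
Proof.
move=> Epc lt_pc Ei; rewrite /step /= Epc lt_pc Ei /=; congr (Some (Config _ _)).
  congr (inord (next_pc _ _ _)).
  by apply: funext => r; rewrite ffunE.
by apply: funext => k; rewrite ffunE.
Qed.

Definition located (o : nat) (c : seq instr) : Prop :=
  exists pre post, code = pre ++ c ++ post /\ size pre = o.

Lemma located_nth o c j : located o c -> j < size c ->
  o + j < size code /\ nth (Goto 0) code (o + j) = nth (Goto 0) c j.
Proof.
case=> pre [post [E <-]] lt_j; rewrite E !size_cat ltn_add2l ltn_addr //.
by rewrite nth_cat ltnNge leq_addr /= addKn nth_cat lt_j.
Qed.

Lemma located_cat o c1 c2 : located o (c1 ++ c2) ->
  located o c1 /\ located (o + size c1) c2.
Proof.
case=> pre [post [E <-]]; split; rewrite /located E.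
  by exists pre, (c2 ++ post); rewrite !catA.
by exists (pre ++ c1), post; rewrite size_cat !catA.
Qed.

(** Induction on the execution. A loop is a test that jumps behind the body,
followed by a jump back; after one round the control is again at the address of
the same loop, where the induction hypothesis for the remaining rounds
applies. *)
Lemma exec_simulation P s s' : exec P s s' -> forall o c,
  located o (compile o P) -> max_reg P <= K -> represents c o s ->
  exists c', reaches c c' /\ represents c' (o + size (compile o P)) s'.
Proof.
elim=> {P s s'}.
- by move=> s o c _ _ Hc; exists c; rewrite addn0; split=> //; exact: reaches_refl.
- move=> r b s o c L /= leK [Ho Ht].
  have [lt0 E0] := located_nth (j := 0) L isT.
  have [lt1 E1] := located_nth (j := 1) L isT.
  rewrite addn0 in lt0 E0; rewrite /= addn1 in lt1 E0 E1.
  have S0 := step_machine Ho lt0 E0.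
  set c0 := Config _ _ in S0.
  have Ho0 : (cfg_state c0 : 'I_(size code).+1) = o.+1 :> nat.
    by rewrite /= inordK // ltnS ltnW.
  have S1 := step_machine Ho0 lt1 E1.
  set c1 := Config _ _ in S1.
  exists c1; split.
    by apply: reaches_trans (reaches_step S0) (reaches_step S1).
  split; first by rewrite addn2 /= inordK // ltnS.
  move=> k; rewrite /c1 /upd /=; case: (k =P r :> nat) => [<-|_].
    exact: tape_holds_push.
  by apply: tape_holds_idle; apply: tape_holds_idle.
- move=> r s o c L /= leK [Ho Ht].
  have [lt0 E0] := located_nth (j := 0) L isT.
  rewrite /= addn0 in lt0 E0.
  have S0 := step_machine Ho lt0 E0.
  set c0 := Config _ _ in S0.
  exists c0; split; first exact: reaches_step S0.
  split; first by rewrite addn1 /= inordK // ltnS.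
  move=> k; rewrite /c0 /upd /=; case: (k =P r :> nat) => [<-|_].
    exact: tape_holds_pop.
  exact: tape_holds_idle.
- move=> P Q s1 s2 s3 _ IHP _ IHQ o c /located_cat [LP LQ] /=.
  rewrite geq_max => /andP[leP leQ] Hc.
  have [c' [R1 H1]] := IHP _ _ LP leP Hc.
  have [c'' [R2 H2]] := IHQ _ _ LQ leQ H1.
  exists c''; split; first exact: reaches_trans R1 R2.
  by rewrite size_cat addnA.
- move=> r P s Hr o c L /=; rewrite geq_max => /andP[leK _] [Ho Ht].
  have [lt0 E0] := located_nth (j := 0) L isT.
  rewrite /= addn0 in lt0 E0.
  have S0 := step_machine Ho lt0 E0.
  set c0 := Config _ _ in S0.
  have pcE : next_pc (Branch r (o + size (compile o.+1 P)).+2) o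
      (fun r => read (cfg_tape c (inord r)))
    = o + (size (rcons (compile o.+1 P) (Goto o))).+1.
    rewrite /= size_rcons !addnS.
    have := tape_holds_read (Ht (inord r)); rewrite inordK ?ltnS // => ->.
    by case: (s r) Hr => [|[] w].
  exists c0; split; first exact: reaches_step S0.
  split; last by move=> k; apply: tape_holds_idle.
  have bnd : o + (size (rcons (compile o.+1 P) (Goto o))).+1 <= size code.
    case: L => pre [post [E oE]]; rewrite E !size_cat oE.
    by rewrite leq_add2l; apply: leq_addr.
  by rewrite /c0 pcE /= inordK.
- move=> r P s1 s2 s3 Hr _ IHP _ IHW o c L leK [Ho Ht].
  move: (leK); rewrite /= geq_max => /andP[ler leP].
  have [lt0 E0] := located_nth (j := 0) L isT.
  rewrite /= addn0 in lt0 E0.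
  have S0 := step_machine Ho lt0 E0.
  set c0 := Config _ _ in S0.
  have pcE : next_pc (Branch r (o + size (compile o.+1 P)).+2) o
      (fun r => read (cfg_tape c (inord r))) = o.+1.
    have := tape_holds_read (Ht (inord r)); rewrite inordK ?ltnS //= => ->.
    by case: (s1 r) Hr => [|[] w].
  have H0 : represents c0 o.+1 s1.
    split; last by move=> k; apply: tape_holds_idle.
    by rewrite /c0 pcE /= inordK // ltnS.
  have [LP LG] : located o.+1 (compile o.+1 P) /\
      located (o.+1 + size (compile o.+1 P)) [:: Goto o].
    apply: located_cat; case: L => pre [post [E oE]].
    exists (rcons pre (Branch r (o + size (compile o.+1 P)).+2)), post.
    by rewrite E size_rcons oE /= -cats1 cat_rcons.
  have [c1 [R1 [Ho1 Ht1]]] := IHP _ _ LP leP H0.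
  have [lt2 E2] := located_nth (j := 0) LG isT.
  rewrite /= addn0 in lt2 E2.
  have S2 := step_machine Ho1 lt2 E2.
  set c2 := Config _ _ in S2.
  have H2 : represents c2 o s2.
    split; last by move=> k; apply: tape_holds_idle.
    by rewrite /c2 /= inordK // ltnS ltnW.
  have [c3 [R3 H3]] := IHW _ _ L leK H2.
  exists c3; split=> //.
  apply: reaches_trans (reaches_step S0) _.
  apply: reaches_trans R1 _.
  exact: reaches_trans (reaches_step S2) R3.
Qed.

End Simulation.

Definition input_store (w : seq bool) : store := upd (fun=> [::]) 0 w.

Definition program_machine (P : program) : turing_machine :=
  machine (compile 0 P) (max_reg P).

Lemma program_machine_computes P u v s :
  exec P (input_store u) s -> s 0 = v ->
  tm_computes (program_machine P) u v.
Proof.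
move=> eP sv; pose M := program_machine P.
have H0 : represents (init M u) 0 (input_store u).
  split=> // k; rewrite /input_store /upd /=.
  by rewrite -[k == ord0]/(k == 0 :> nat); case: ifP => _; exists 0; rewrite ?cats0.
have L : located (compile 0 P) 0 (compile 0 P).
  by exists [::], [::]; rewrite cats0.
have [c [[n Rn] [pcE tE]]] := exec_simulation eP L (leqnn _) H0.
exists n, c; split=> //.
  by rewrite /step /= pcE add0n ltnn.
rewrite /outputs; have [j ->] := tE ord0.
rewrite [s _]sv find_cat.
have -> : has (fun a : symbol void => ~~ isSome a) [seq Some (inl b) | b <- v] = false.
  by elim: v {sv}.
have -> : find (fun a : symbol void => ~~ isSome a) (nseq j None) = 0.
  by case: j.
by rewrite addn0 take_size_cat.
Qed.

(** * Functions and words computed by programs *)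

Definition unary (n : nat) : seq bool := nseq n true.

Lemma upd_same s r w : upd s r w r = w.
Proof. by rewrite /upd eqxx. Qed.

Lemma upd_other s r w i : i != r -> upd s r w i = s i.
Proof. by rewrite /upd => /negbTE ->. Qed.

Lemma exec_eq P s t t' : exec P s t -> t =1 t' -> exec P s t'.
Proof. by move=> H /funext <-. Qed.

(** Stores are functions, and their values are compared register by register. *)
Ltac case_registers := let i := fresh "i" in
  try move=> i; rewrite /upd; repeat (case: eqP => ?; try lia); subst; rewrite ?eqxx //=.

Definition move_unary (src dst : nat) : program :=
  While src (Seq (Pop src) (Push dst true)).

Lemma exec_move_unary src dst s m n : src != dst ->
  s src = unary m -> s dst = unary n ->
  exec (move_unary src dst) s (upd (upd s src [::]) dst (unary (m + n))).
Proof.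
move=> neq; elim: m n s => [|m IH] n s Hs Hd.
  apply: exec_eq; first by apply: ExecDone; rewrite Hs.
  by case_registers.
apply: ExecLoop; first by rewrite Hs.
  by apply: ExecSeq; [exact: ExecPop | exact: ExecPush].
apply: exec_eq.
  apply: (IH n.+1).
    by rewrite upd_other // upd_same Hs.
  by rewrite upd_same upd_other ?Hd // eq_sym.
by move=> i; rewrite addnS; case_registers.
Qed.

Definition clear (r : nat) : program := While r (Pop r).

Lemma exec_clear r s m : s r = unary m -> exec (clear r) s (upd s r [::]).
Proof.
elim: m s => [|m IH] s Hs.
  by apply: exec_eq; [apply: ExecDone; rewrite Hs | case_registers].
apply: ExecLoop; [by rewrite Hs | exact: ExecPop | ].
apply: exec_eq; first by apply: IH; rewrite upd_same Hs.
by case_registers.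
Qed.

Definition copy_unary (src dst tmp : nat) : program :=
  Seq (While src (Seq (Pop src) (Seq (Push dst true) (Push tmp true))))
    (move_unary tmp src).

Lemma exec_copy_unary src dst tmp s n :
  src < dst -> dst < tmp -> s src = unary n -> s dst = [::] -> s tmp = [::] ->
  exec (copy_unary src dst tmp) s (upd s dst (unary n)).
Proof.
move=> lt1 lt2 Hs Hd Ht.
have loop m s' : s' src = unary m -> forall a, s' dst = unary a ->
    s' tmp = unary a ->
    exec (While src (Seq (Pop src) (Seq (Push dst true) (Push tmp true)))) s'
      (upd (upd (upd s' src [::]) dst (unary (m + a))) tmp (unary (m + a))).
  elim: m s' => [|m IH] s' Es a Ed Et.
    by apply: exec_eq; [apply: ExecDone; rewrite Es | case_registers].
  apply: ExecLoop; first by rewrite Es.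
    apply: ExecSeq; first exact: ExecPop.
    by apply: ExecSeq; exact: ExecPush.
  apply: exec_eq.
    by apply: (IH _ _ a.+1); case_registers; rewrite ?Es ?Ed ?Et.
  by move=> i; rewrite addnS; case_registers.
apply: ExecSeq; first by apply: (loop n s Hs 0); rewrite ?Hd ?Ht.
apply: exec_eq.
  by apply: (@exec_move_unary _ _ _ (n + 0) 0); case_registers; lia.
by move=> i; rewrite !addn0; case_registers.
Qed.

(** Values of the variables in scope; the innermost one is the last component. *)
Fixpoint env (k : nat) : Type := if k is k'.+1 then (env k' * nat)%type else unit.

Fixpoint values (k : nat) : env k -> seq nat :=
  match k with
  | 0 => fun=> [::]
  | k'.+1 => fun e => e.2 :: values e.1
  end.

Definition in_registers (rho : seq nat) k (e : env k) (s : store) : Prop :=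
  [seq s r | r <- rho] = [seq unary n | n <- values e].

(** The variables sit in arbitrary registers below [dst], and everything from
[dst] on is empty scratch space that is left empty apart from the result. This
is what allows programs to be nested. *)
Definition computable k (f : env k -> nat) : Prop :=
  forall rho dst, size rho = k -> all (fun r => r < dst) rho ->
  exists P, forall s e, in_registers rho e s ->
    (forall i, dst <= i -> s i = [::]) ->
    exec P s (upd s dst (unary (f e))).

Lemma computable_ext k (f g : env k -> nat) :
  f =1 g -> computable f -> computable g.
Proof.
move=> E Cf rho dst Hr Hd; have [P HP] := Cf rho dst Hr Hd.
by exists P => s e; rewrite -E; apply: HP.
Qed.

Lemma in_registers_upd rho k (e : env k) s dst w :
  all (fun r => r < dst) rho ->
  in_registers rho e s -> in_registers rho e (upd s dst w).
Proof.
move=> /allP lt_rho; rewrite /in_registers => <-; apply/eq_in_map => r /lt_rho.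
by move=> lt_r; rewrite upd_other // neq_ltn lt_r.
Qed.

Lemma registers_below_le d d' rho : d <= d' ->
  all (fun r => r < d) rho -> all (fun r => r < d') rho.
Proof. by move=> le_d; apply: sub_all => r lt_r; apply: leq_trans lt_r le_d. Qed.

Lemma computable_last k : computable (fun e : env k.+1 => e.2).
Proof.
move=> [|r rho] dst //= _ /andP[lt_r _]; exists (copy_unary r dst dst.+1).
move=> s e [Er _] empty.
by apply: exec_copy_unary => //; apply: empty; lia.
Qed.

Lemma computable_weaken k (f : env k -> nat) :
  computable f -> computable (fun e : env k.+1 => f e.1).
Proof.
move=> Cf [|r rho] dst //= [Hr] /andP[_ Hd]; have [P HP] := Cf rho dst Hr Hd.
by exists P => s e [_ E]; apply: HP.
Qed.

Lemma computable_zero k : computable (fun _ : env k => 0).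
Proof.
move=> rho dst _ _; exists Skip => s e _ empty.
by apply: exec_eq; [exact: ExecSkip | case_registers; rewrite empty].
Qed.

Lemma computable_succ k (f : env k -> nat) :
  computable f -> computable (fun e => (f e).+1).
Proof.
move=> Cf rho dst Hr Hd; have [P HP] := Cf rho dst Hr Hd.
exists (Seq P (Push dst true)) => s e Hs empty.
apply: ExecSeq; first exact: HP Hs empty.
by apply: exec_eq; [exact: ExecPush | case_registers].
Qed.

(** Registers [dst], [dst.+1] and [dst.+2] hold the accumulator, the number of
rounds left and the loop index; the body works above them. *)
Lemma computable_rec k (a b : env k -> nat) (u : env k -> nat -> nat -> nat) :
  computable a -> computable b ->
  computable (fun e : env k.+2 => u e.1.1 e.1.2 e.2) ->
  computable (fun e => iteri (a e) (u e) (b e)).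
Proof.
move=> Ca Cb Cu rho dst Hr Hd.
have [Pb HPb] := Cb rho dst Hr Hd.
have Hd1 : all (fun r => r < dst.+1) rho by apply: registers_below_le Hd; lia.
have [Pa HPa] := Ca rho dst.+1 Hr Hd1.
have Hd3 : all (fun r => r < dst.+3) (dst :: dst.+2 :: rho).
  by rewrite /= (registers_below_le _ Hd) ?andbT; lia.
have [Pu HPu] := Cu (dst :: dst.+2 :: rho) dst.+3 (congr1 (addn 2) Hr) Hd3.
pose body := Seq (Pop dst.+1) (Seq Pu (Seq (clear dst)
  (Seq (move_unary dst.+3 dst) (Push dst.+2 true)))).
exists (Seq Pb (Seq Pa (Seq (While dst.+1 body) (clear dst.+2)))) => s e Hs empty.
pose acc j := iteri j (u e) (b e).
pose st j m := upd (upd (upd s dst (unary (acc j))) dst.+1 (unary m))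
  dst.+2 (unary j).
have keep s' r w : dst <= r -> in_registers rho e s' ->
    in_registers rho e (upd s' r w).
  by move=> le_r; apply: in_registers_upd; apply: registers_below_le Hd.
have bodyP j m : exec body (st j m.+1) (st j.+1 m).
  apply: ExecSeq; first exact: ExecPop.
  apply: ExecSeq.
    apply: (HPu _ ((e, j), acc j)); last first.
      by move=> i le_i; rewrite /st; case_registers; rewrite empty //; lia.
    rewrite /in_registers /=; congr [:: _, _ & _].
    - by rewrite /st; case_registers.
    - by rewrite /st; case_registers.
    - by rewrite /st; do 4![apply: (keep); first lia].
  apply: ExecSeq.
    by apply: (@exec_clear _ _ (acc j)); rewrite /st; case_registers.
  apply: ExecSeq.
    by apply: (@exec_move_unary _ _ _ (acc j.+1) 0); rewrite /st; case_registers; lia.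
  apply: exec_eq; first exact: ExecPush.
  by move=> i; rewrite addn0 /st; case_registers; rewrite empty //; lia.
have loopP m j : exec (While dst.+1 body) (st j m) (st (j + m) 0).
  elim: m j => [|m IH] j.
    by rewrite addn0; apply: ExecDone; rewrite /st; case_registers.
  apply: ExecLoop (bodyP j m) _.
    by rewrite /st upd_other ?upd_same //; lia.
  by rewrite -addSnnS; apply: IH.
apply: ExecSeq; first exact: HPb Hs empty.
apply: ExecSeq.
  apply: (HPa _ e); first exact: in_registers_upd Hd Hs.
  by move=> i le_i; rewrite upd_other ?empty //; lia.
apply: ExecSeq.
  rewrite (_ : upd _ _ _ = st 0 (a e)); first exact: loopP.
  by apply: funext => i; rewrite /st; case_registers; rewrite empty //; lia.
apply: exec_eq.
  by apply: (@exec_clear _ _ (0 + a e)); rewrite /st; case_registers.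
by rewrite add0n /st; case_registers; rewrite empty //; lia.
Qed.

Lemma computable_app k (F : nat -> nat) (g : env k -> nat) :
  computable (fun e : env 1 => F e.2) -> computable g ->
  computable (fun e => F (g e)).
Proof.
move=> CF Cg.
apply: (@computable_ext _ (fun e => iteri 1 (fun _ _ => F (g e)) 0)) => //.
move=> rho dst Hr Hd.
have [P HP] := Cg rho dst.+1 Hr (registers_below_le (leqnSn _) Hd).
have [Q HQ] := CF [:: dst.+1] dst.+2 erefl (ltac:(by rewrite /= ltnSn)).
exists (Seq P (Seq Q (Seq (clear dst.+1) (move_unary dst.+2 dst)))) => s e Hs empty.
apply: ExecSeq.
  by apply: HP Hs _ => i le_i; rewrite empty //; lia.
apply: ExecSeq.
  apply: (HQ _ (tt, g e)); first by rewrite /in_registers /= upd_same.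
  by move=> i le_i; rewrite upd_other ?empty //; lia.
apply: ExecSeq; first by apply: (@exec_clear _ _ (g e)); case_registers.
apply: exec_eq.
  by apply: (@exec_move_unary _ _ _ (F (g e)) 0); case_registers; rewrite ?empty //; lia.
by move=> i; rewrite addn0; case_registers; rewrite empty //; lia.
Qed.

Lemma computable_app2 k (F : nat -> nat -> nat) (g h : env k -> nat) :
  computable (fun e : env 2 => F e.1.2 e.2) -> computable g -> computable h ->
  computable (fun e => F (g e) (h e)).
Proof.
move=> CF Cg Ch rho dst Hr Hd.
have [P1 HP1] := Cg rho dst.+1 Hr (registers_below_le (leqnSn _) Hd).
have Hd2 : all (fun r => r < dst.+2) rho by apply: registers_below_le Hd; lia.
have [P2 HP2] := Ch rho dst.+2 Hr Hd2.
have [Q HQ] := CF [:: dst.+2; dst.+1] dst.+3 erefl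
  (ltac:(by rewrite /= !ltnS leqnn leqnSn)).
exists (Seq P1 (Seq P2 (Seq Q (Seq (clear dst.+1) (Seq (clear dst.+2)
  (move_unary dst.+3 dst)))))) => s e Hs empty.
apply: ExecSeq.
  by apply: HP1 Hs _ => i le_i; rewrite empty //; lia.
apply: ExecSeq.
  apply: (HP2 _ e).
    by apply: in_registers_upd => //; apply: registers_below_le Hd; lia.
  by move=> i le_i; rewrite upd_other ?empty //; lia.
apply: ExecSeq.
  apply: (HQ _ ((tt, g e), h e)).
    by rewrite /in_registers /= upd_same upd_other ?upd_same //; lia.
  by move=> i le_i; rewrite !upd_other ?empty //; lia.
apply: ExecSeq; first by apply: (@exec_clear _ _ (g e)); case_registers.
apply: ExecSeq; first by apply: (@exec_clear _ _ (h e)); case_registers.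
apply: exec_eq.
  by apply: (@exec_move_unary _ _ _ (F (g e) (h e)) 0); case_registers; rewrite ?empty //; lia.
by move=> i; rewrite addn0; case_registers; rewrite empty //; lia.
Qed.

(** Words are printed on register 0, in front of what is already there; hence a
concatenation prints its second word first. *)
Definition printable k (w : env k -> seq bool) : Prop :=
  forall rho dst, size rho = k -> all (fun r => 0 < r < dst) rho -> 0 < dst ->
  exists P, forall s e, in_registers rho e s ->
    (forall i, dst <= i -> s i = [::]) ->
    exec P s (upd s 0 (w e ++ s 0)).

Lemma printable_ext k (f g : env k -> seq bool) :
  f =1 g -> printable f -> printable g.
Proof.
move=> E Cf rho dst Hr Hd H0; have [P HP] := Cf rho dst Hr Hd H0.
by exists P => s e; rewrite -E; apply: HP.
Qed.

Lemma in_registers_upd0 rho dst k (e : env k) s w :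
  all (fun r => 0 < r < dst) rho ->
  in_registers rho e s -> in_registers rho e (upd s 0 w).
Proof.
move=> /allP lt_rho; rewrite /in_registers => <-; apply/eq_in_map => r /lt_rho.
by case: r.
Qed.

Lemma registers_below rho dst : all (fun r => 0 < r < dst) rho -> all (fun r => r < dst) rho.
Proof. by apply: sub_all => r /andP[]. Qed.

Lemma printable_const k w : printable (fun _ : env k => w).
Proof.
elim: w => [|b w IH] rho dst Hr Hd H0.
  exists Skip => s e _ _; apply: exec_eq; first exact: ExecSkip.
  by case_registers.
have [P HP] := IH rho dst Hr Hd H0.
exists (Seq P (Push 0 b)) => s e Hs empty.
apply: ExecSeq; first exact: HP Hs empty.
by apply: exec_eq; [exact: ExecPush | case_registers].
Qed.

Lemma printable_cat k (w1 w2 : env k -> seq bool) :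
  printable w1 -> printable w2 -> printable (fun e => w1 e ++ w2 e).
Proof.
move=> C1 C2 rho dst Hr Hd H0.
have [P1 HP1] := C1 rho dst Hr Hd H0; have [P2 HP2] := C2 rho dst Hr Hd H0.
exists (Seq P2 P1) => s e Hs empty.
apply: ExecSeq; first exact: HP2 Hs empty.
apply: exec_eq.
  apply: (HP1 _ e); first exact: in_registers_upd0 Hd Hs.
  by move=> i le_i; rewrite upd_other ?empty //; lia.
by case_registers; rewrite catA.
Qed.

Lemma printable_unary k (f : env k -> nat) :
  computable f -> printable (fun e => unary (f e)).
Proof.
move=> Cf rho dst Hr Hd H0; have [P HP] := Cf rho dst Hr (registers_below Hd).
exists (Seq P (While dst (Seq (Pop dst) (Push 0 true)))) => s e Hs empty.
apply: ExecSeq; first exact: HP Hs empty.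
have loop m s' : s' dst = unary m ->
  exec (While dst (Seq (Pop dst) (Push 0 true))) s'
    (upd (upd s' dst [::]) 0 (unary m ++ s' 0)).
  elim: m s' => [|m IH] s' E.
    by apply: exec_eq; [apply: ExecDone; rewrite E | case_registers].
  apply: ExecLoop; first by rewrite E.
    by apply: ExecSeq; [exact: ExecPop | exact: ExecPush].
  apply: exec_eq; first by apply: IH; rewrite upd_other ?upd_same ?E //; lia.
  by case_registers; elim: (m) => //= m' ->.
apply: exec_eq; first by apply: loop; rewrite upd_same.
by case_registers; rewrite ?empty.
Qed.

(** Both branches are loops with at most one round. The flag in [dst.+1] starts
the second loop unless the first one has removed it. *)
Lemma printable_if k (f : env k -> nat) (w1 w2 : env k -> seq bool) :
  computable f -> printable w1 -> printable w2 ->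
  printable (fun e => if 0 < f e then w1 e else w2 e).
Proof.
move=> Cf C1 C2 rho dst Hr Hd H0; have [P HP] := Cf rho dst Hr (registers_below Hd).
have Hd2 : all (fun r => 0 < r < dst.+2) rho.
  by apply: sub_all Hd => r; lia.
have [P1 HP1] := C1 rho dst.+2 Hr Hd2 isT.
have [P2 HP2] := C2 rho dst.+2 Hr Hd2 isT.
exists (Seq P (Seq (Push dst.+1 true)
  (Seq (While dst (Seq (clear dst) (Seq P1 (Pop dst.+1))))
    (While dst.+1 (Seq (Pop dst.+1) P2))))) => s e Hs empty.
apply: ExecSeq; first exact: HP Hs empty.
apply: ExecSeq; first exact: ExecPush.
case: posnP => [->|f_gt0].
  apply: ExecSeq; first by apply: ExecDone; case_registers.
  have E : upd (upd (upd s dst (unary 0)) dst.+1 (true :: upd s dst (unary 0) dst.+1))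
     dst.+1 (behead (upd (upd s dst (unary 0)) dst.+1
       (true :: upd s dst (unary 0) dst.+1) dst.+1)) = s.
    by apply: funext => i; case_registers; rewrite empty.
  apply: ExecLoop; first by rewrite upd_same.
    apply: ExecSeq; first exact: ExecPop.
    rewrite E; apply: (HP2 _ e Hs) => i le_i; rewrite empty //; lia.
  by apply: ExecDone; case_registers; rewrite empty.
have E : upd (upd (upd s dst (unary (f e))) dst.+1 (true :: upd s dst (unary (f e)) dst.+1))
     dst [::] = upd s dst.+1 [:: true].
  by apply: funext => i; case_registers; rewrite ?empty.
apply: ExecSeq.
  apply: ExecLoop.
  - by case_registers; case: (f e) f_gt0.
  - apply: ExecSeq; first by apply: (@exec_clear _ _ (f e)); case_registers.
    rewrite E; apply: ExecSeq; last exact: ExecPop.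
    apply: (HP1 _ e).
      by apply: in_registers_upd Hs; apply: registers_below_le (registers_below Hd).
    by move=> i le_i; rewrite upd_other ?empty //; lia.
  - by apply: ExecDone; case_registers; rewrite empty.
apply: exec_eq; first by apply: ExecDone; case_registers; rewrite ?empty.
by case_registers; rewrite empty.
Qed.

Lemma printable_nat_word k (f : env k -> nat) :
  computable f -> printable (fun e => nat_word (f e)).
Proof.
move=> Cf; rewrite /nat_word.
apply: (printable_ext (f := fun e => unary (f e) ++ [:: false])).
  by move=> e; rewrite cats1.
by apply: printable_cat; [exact: printable_unary | exact: printable_const].
Qed.

(** The input 1^n 0 arrives on the output register, so it is first moved to
register 1. *)
Theorem printable_computes (w : nat -> seq bool) :
  printable (fun e : env 1 => w e.2) ->
  exists M, forall n, tm_computes M (nat_word n) (w n).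
Proof.
move=> /(_ [:: 1] 2 erefl erefl isT) [P HP].
exists (program_machine (Seq (move_unary 0 1) (Seq (Pop 0) P))) => n.
pose s := upd (fun=> [::]) 1 (unary n).
have Hs : in_registers [:: 1] ((tt, n) : env 1) s by [].
have He i : 2 <= i -> s i = [::] by move=> le_i; rewrite /s upd_other //; lia.
have run := HP s (tt, n) Hs He.
apply: (program_machine_computes (s := upd s 0 (w n ++ [::]))); last first.
  by rewrite upd_same cats0.
have loop m a : exec (move_unary 0 1)
    (upd (upd (fun=> [::]) 0 (nat_word m)) 1 (unary a))
    (upd (upd (fun=> [::]) 0 [:: false]) 1 (unary (a + m))).
  elim: m a => [|m IH] a; first by rewrite addn0; apply: ExecDone.
  apply: ExecLoop; first by [].
    by apply: ExecSeq; [exact: ExecPop | exact: ExecPush].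
  rewrite -addSnnS (_ : upd _ _ _ = upd (upd (fun=> [::]) 0 (nat_word m)) 1 (unary a.+1)).
    exact: IH.
  by apply: funext => i; case_registers.
have := loop n 0; rewrite add0n => L.
apply: ExecSeq.
  rewrite (_ : input_store _ = upd (upd (fun=> [::]) 0 (nat_word n)) 1 (unary 0)).
    exact: L.
  by apply: funext => i; rewrite /input_store; case_registers.
apply: ExecSeq; first exact: ExecPop.
rewrite (_ : upd _ _ _ = s); first exact: run.
by apply: funext => i; rewrite /s; case_registers.
Qed.

(** * Primitive recursive, rational and complex arithmetic *)

Lemma computable_const k c : computable (fun _ : env k => c).
Proof.
elim: c => [|c IH]; [exact: computable_zero | exact: computable_succ].
Qed.

Lemma computable_add k (f g : env k -> nat) :
  computable f -> computable g -> computable (fun e => f e + g e).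
Proof.
move=> Cf Cg.
apply: (computable_ext (f := fun e => iteri (g e) (fun _ r => r.+1) (f e))).
  by move=> e; elim: (g e) => [|n IH] /=; rewrite ?addn0 // addnS IH.
apply: computable_rec => //.
by apply: (@computable_succ k.+2); apply: computable_last.
Qed.

Lemma computable_mul k (f g : env k -> nat) :
  computable f -> computable g -> computable (fun e => f e * g e).
Proof.
move=> Cf Cg.
apply: (computable_ext (f := fun e => iteri (f e) (fun _ r => r + g e) 0)).
  by move=> e; elim: (f e) => //= n ->; rewrite mulSn addnC.
apply: computable_rec => //; first exact: computable_zero.
apply: (@computable_add k.+2); first exact: computable_last.
exact: (computable_weaken (computable_weaken Cg)).
Qed.

Lemma computable_pred k (f : env k -> nat) :
  computable f -> computable (fun e => (f e).-1).
Proof.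
move=> Cf; apply: (computable_ext (f := fun e => iteri (f e) (fun x _ => x) 0)).
  by move=> e; case: (f e).
apply: computable_rec => //; first exact: computable_zero.
exact: (computable_weaken (@computable_last k)).
Qed.

Lemma computable_sub k (f g : env k -> nat) :
  computable f -> computable g -> computable (fun e => f e - g e).
Proof.
move=> Cf Cg.
apply: (computable_ext (f := fun e => iteri (g e) (fun _ r => r.-1) (f e))).
  by move=> e; elim: (g e) => [|n IH] /=; rewrite ?subn0 // IH subnS.
apply: computable_rec => //.
by apply: (@computable_pred k.+2); apply: computable_last.
Qed.

Lemma computable_exp2 k (f : env k -> nat) :
  computable f -> computable (fun e => 2 ^ f e).
Proof.
move=> Cf; apply: (computable_ext (f := fun e => iteri (f e) (fun _ r => r + r) 1)).
  by move=> e; elim: (f e) => //= n ->; rewrite expnS mul2n addnn.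
apply: computable_rec => //; first exact: computable_const.
by apply: (@computable_add k.+2); apply: computable_last.
Qed.

Lemma computable_expn k (f : env k -> nat) c :
  computable f -> computable (fun e => f e ^ c).
Proof.
move=> Cf; elim: c => [|c IH]; first by apply: computable_ext (@computable_const k 1) => e.
by apply: (computable_ext (f := fun e => f e * f e ^ c));
  [move=> e; rewrite expnS | apply: computable_mul].
Qed.

Definition decidable_on k (P : env k -> bool) : Prop :=
  computable (fun e => nat_of_bool (P e)).

Lemma decidable_leq k (f g : env k -> nat) :
  computable f -> computable g -> decidable_on (fun e => f e <= g e).
Proof.
move=> Cf Cg; apply: (computable_ext (f := fun e => 1 - (f e - g e))).
  by move=> e; lia.
by apply: computable_sub; [exact: computable_const | exact: computable_sub].
Qed.

Lemma decidable_and k (P Q : env k -> bool) :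
  decidable_on P -> decidable_on Q -> decidable_on (fun e => P e && Q e).
Proof.
move=> CP CQ; apply: computable_ext (computable_mul CP CQ) => e.
by rewrite mulnb.
Qed.

Lemma decidable_neg k (P : env k -> bool) :
  decidable_on P -> decidable_on (fun e => ~~ P e).
Proof.
move=> CP; apply: computable_ext (computable_sub (@computable_const k 1) CP) => e.
by case: (P e).
Qed.

Lemma decidable_imply k (P Q : env k -> bool) :
  decidable_on P -> decidable_on Q -> decidable_on (fun e => P e ==> Q e).
Proof.
move=> CP CQ.
apply: computable_ext (decidable_neg (decidable_and CP (decidable_neg CQ))) => e.
by case: (P e) (Q e) => [] [].
Qed.

Lemma decidable_eq k (f g : env k -> nat) :
  computable f -> computable g -> decidable_on (fun e => f e == g e).
Proof.
move=> Cf Cg; apply: computable_ext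
  (decidable_and (decidable_leq Cf Cg) (decidable_leq Cg Cf)) => e.
by rewrite -eqn_leq.
Qed.

Lemma decidable_all k (b : env k -> nat) (P : env k -> nat -> bool) :
  computable b -> decidable_on (fun e : env k.+1 => P e.1 e.2) ->
  decidable_on (fun e => all (P e) (iota 0 (b e))).
Proof.
move=> Cb CP; apply: (computable_ext
  (f := fun e => iteri (b e) (fun x r => r * P e x) 1)).
  move=> e; elim: (b e) => // n IH; rewrite [LHS]/= IH.
  by rewrite -[in RHS]addn1 iotaD all_cat /= andbT mulnb.
apply: computable_rec => //; first exact: computable_const.
apply: (@computable_mul k.+2); first exact: computable_last.
exact: (computable_weaken CP).
Qed.

Definition isqrt (n : nat) : nat := iteri n (fun x r => r + (x.+1 * x.+1 <= n)) 0.

Definition unpair_fst (n : nat) : nat := n - isqrt n * isqrt n.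
Definition unpair_snd (n : nat) : nat := isqrt n - unpair_fst n.

Definition pair_code (a b : nat) : nat := (a + b) * (a + b) + a.

(** The code of (a, b) lies between the squares of a + b and a + b + 1, so its
integer square root is a + b. *)
Lemma isqrt_pair_code a b : isqrt (pair_code a b) = a + b.
Proof.
have gen n : iteri n (fun x r => r + (x.+1 * x.+1 <= pair_code a b)) 0 =
    minn n (a + b).
  elim: n => [|n /= ->]; first by rewrite min0n.
  have [lt_n|le_n] := ltnP n (a + b).
    have -> : n.+1 * n.+1 <= pair_code a b.
      by apply: leq_trans (leq_mul lt_n lt_n) _; apply: leq_addr.
    by rewrite addn1; lia.
  have -> : (n.+1 * n.+1 <= pair_code a b) = false.
    apply/negbTE; rewrite -ltnNge /pair_code.
    have := leq_mul le_n le_n; lia.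
  by lia.
by rewrite /isqrt gen; apply/minn_idPr; rewrite /pair_code; nia.
Qed.

Lemma unpair_fst_code a b : unpair_fst (pair_code a b) = a.
Proof. by rewrite /unpair_fst isqrt_pair_code addKn. Qed.

Lemma unpair_snd_code a b : unpair_snd (pair_code a b) = b.
Proof. by rewrite /unpair_snd unpair_fst_code isqrt_pair_code addKn. Qed.

Lemma computable_isqrt k (f : env k -> nat) :
  computable f -> computable (fun e => isqrt (f e)).
Proof.
apply: computable_app; apply: (@computable_rec 1) => //.
- exact: computable_last.
- exact: computable_zero.
apply: (@computable_add 3); first exact: computable_last.
have Cx : computable (fun e : env 3 => e.1.2.+1).
  exact: computable_succ (computable_weaken (@computable_last 1)).
apply: (@decidable_leq 3); first exact: computable_mul.
exact: (computable_weaken (computable_weaken (@computable_last 0))).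
Qed.

Lemma computable_unpair_fst k (f : env k -> nat) :
  computable f -> computable (fun e => unpair_fst (f e)).
Proof.
move=> Cf; apply: computable_sub => //.
by apply: computable_mul; apply: computable_isqrt.
Qed.

Lemma computable_unpair_snd k (f : env k -> nat) :
  computable f -> computable (fun e => unpair_snd (f e)).
Proof.
by move=> Cf; apply: computable_sub; [apply: computable_isqrt | apply: computable_unpair_fst].
Qed.

(** A number codes the list of the first components of its iterated second
components. *)
Definition entry (t j : nat) : nat := unpair_fst (iter j unpair_snd t).

Lemma entry_surjective (f : nat -> nat) k :
  exists t, forall j, j < k -> entry t j = f j.
Proof.
elim: k f => [|k IH] f; first by exists 0.
have [t Ht] := IH (fun j => f j.+1).
exists (pair_code (f 0) t) => -[|j] lt_j; first by rewrite /entry unpair_fst_code.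
by rewrite /entry iterSr unpair_snd_code; apply: Ht.
Qed.

Lemma entry2_surjective (f : nat -> nat -> nat) k :
  exists t, forall u v, u < k -> v < k -> entry (entry t u) v = f u v.
Proof.
have [g Hg] := choice (fun u => entry_surjective (f u) k).
have [t Ht] := entry_surjective g k.
by exists t => u v lt_u lt_v; rewrite Ht // Hg.
Qed.

Lemma computable_entry k (f g : env k -> nat) :
  computable f -> computable g -> computable (fun e => entry (f e) (g e)).
Proof.
apply: computable_app2; apply: computable_unpair_fst.
apply: (computable_ext (f := fun e : env 2 => iteri e.2 (fun _ => unpair_snd) e.1.2)).
  by move=> e; elim: (e.2) => //= n ->.
apply: (@computable_rec 2 _ _ (fun _ _ => unpair_snd)).
- exact: computable_last.
- exact: computable_weaken (@computable_last 0).
- by apply: (@computable_unpair_snd 4); apply: computable_last.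
Qed.

Import Order.TTheory GRing.Theory Num.Theory.
Local Open Scope ring_scope.

(** Programs have natural values; differences supply the signs, and successors
keep the denominators away from 0. *)
Definition rational_computable k (q : env k -> rat) : Prop :=
  exists a b c : env k -> nat, [/\ computable a, computable b, computable c &
    forall e, q e = ((a e)%:R - (b e)%:R) / (c e).+1%:R].

Lemma rational_ext k (f g : env k -> rat) :
  f =1 g -> rational_computable f -> rational_computable g.
Proof. by move=> E [a [b [c [? ? ? H]]]]; exists a, b, c; split=> // e; rewrite -E. Qed.

Lemma rational_nat k (f : env k -> nat) :
  computable f -> rational_computable (fun e => (f e)%:R).
Proof.
move=> Cf; exists f, (fun=> 0%N), (fun=> 0%N).
by split=> // [||e]; [exact: computable_zero | exact: computable_zero | rewrite subr0 divr1].
Qed.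

Lemma rational_inv k (f : env k -> nat) :
  computable f -> rational_computable (fun e => (f e)%:R^-1).
Proof.
move=> Cf; exists (fun e => (0 < f e)%N), (fun=> 0%N), (fun e => (f e).-1).
split=> [|||e].
- by apply: decidable_leq => //; apply: computable_const.
- exact: computable_zero.
- exact: computable_pred.
- by case: (f e) => [|n]; rewrite subr0 ?invr0 ?mul0r //= mul1r.
Qed.

Lemma rational_opp k (f : env k -> rat) :
  rational_computable f -> rational_computable (fun e => - f e).
Proof.
move=> [a [b [c [Ca Cb Cc E]]]]; exists b, a, c.
by split=> // e; rewrite E -mulNr opprB.
Qed.

Lemma rational_add k (f g : env k -> rat) :
  rational_computable f -> rational_computable g ->
  rational_computable (fun e => f e + g e).
Proof.
move=> [a [b [c [Ca Cb Cc E]]]] [a' [b' [c' [Ca' Cb' Cc' E']]]].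
exists (fun e => a e * (c' e).+1 + a' e * (c e).+1)%N.
exists (fun e => b e * (c' e).+1 + b' e * (c e).+1)%N.
exists (fun e => c e * (c' e).+1 + c' e)%N.
split; try by
  do ![apply: computable_add | apply: computable_mul | apply: computable_succ].
move=> e; rewrite E E'.
have -> : (c e * (c' e).+1 + c' e)%N.+1 = ((c e).+1 * (c' e).+1)%N by lia.
rewrite !natrD !natrM; field.
by rewrite !nat1r !pnatr_eq0.
Qed.

Lemma rational_mul k (f g : env k -> rat) :
  rational_computable f -> rational_computable g ->
  rational_computable (fun e => f e * g e).
Proof.
move=> [a [b [c [Ca Cb Cc E]]]] [a' [b' [c' [Ca' Cb' Cc' E']]]].
exists (fun e => a e * a' e + b e * b' e)%N.
exists (fun e => a e * b' e + b e * a' e)%N.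
exists (fun e => c e * (c' e).+1 + c' e)%N.
split; try by
  do ![apply: computable_add | apply: computable_mul | apply: computable_succ].
move=> e; rewrite E E'.
have -> : (c e * (c' e).+1 + c' e)%N.+1 = ((c e).+1 * (c' e).+1)%N by lia.
rewrite !natrD !natrM; field.
by rewrite !nat1r !pnatr_eq0.
Qed.

Lemma rational_sub k (f g : env k -> rat) :
  rational_computable f -> rational_computable g ->
  rational_computable (fun e => f e - g e).
Proof. by move=> Cf Cg; apply: rational_add => //; apply: rational_opp. Qed.

Lemma rational_sum k (I : Type) (s : seq I) (F : I -> env k -> rat) :
  (forall i, rational_computable (F i)) ->
  rational_computable (fun e => \sum_(i <- s) F i e).
Proof.
move=> CF; elim: s => [|i s IH].
  apply: rational_ext (rational_nat (@computable_zero k)) => e.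
  by rewrite big_nil.
apply: rational_ext (rational_add (CF i) IH) => e.
by rewrite big_cons.
Qed.

Lemma decidable_le_rational k (f g : env k -> rat) :
  rational_computable f -> rational_computable g ->
  decidable_on (fun e => f e <= g e).
Proof.
move=> [a [b [c [Ca Cb Cc E]]]] [a' [b' [c' [Ca' Cb' Cc' E']]]].
apply: (computable_ext (f := fun e =>
  (a e * (c' e).+1 + b' e * (c e).+1 <= a' e * (c e).+1 + b e * (c' e).+1)%N : nat)).
  move=> e; congr (nat_of_bool _); rewrite E E'.
  rewrite ler_pdivrMr ?ltr0n // mulrAC ler_pdivlMr ?ltr0n //.
  rewrite -(ler_nat rat) !natrD !natrM.
  by rewrite !mulrBl -subr_ge0 -[in RHS]subr_ge0; congr (_ <= _); ring.
by apply: decidable_leq;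
  do ![apply: computable_add | apply: computable_mul | apply: computable_succ].
Qed.

Definition complex_computable k (z : env k -> rat[i]) : Prop :=
  rational_computable (fun e => complex.Re (z e)) /\
  rational_computable (fun e => complex.Im (z e)).

Lemma complex_ext k (f g : env k -> rat[i]) :
  f =1 g -> complex_computable f -> complex_computable g.
Proof.
by move=> E [H1 H2]; split; [move: H1 | move: H2]; apply: rational_ext => e; rewrite E.
Qed.

Lemma complex_make k (a b : env k -> rat) :
  rational_computable a -> rational_computable b ->
  complex_computable (fun e => a e +i* b e)%C.
Proof. by []. Qed.

Lemma complex_zero k : complex_computable (fun _ : env k => 0).
Proof. by split; apply: rational_nat (@computable_zero k). Qed.

Lemma complex_one k : complex_computable (fun _ : env k => 1).
Proof.
by split; [apply: rational_nat (@computable_const k 1) | apply: rational_nat (@computable_zero k)].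
Qed.

Lemma complex_add k (f g : env k -> rat[i]) :
  complex_computable f -> complex_computable g ->
  complex_computable (fun e => f e + g e).
Proof.
move=> [f1 f2] [g1 g2]; split.
  by apply: rational_ext (rational_add f1 g1) => e; case: (f e) (g e) => a b [].
by apply: rational_ext (rational_add f2 g2) => e; case: (f e) (g e) => a b [].
Qed.

Lemma complex_opp k (f : env k -> rat[i]) :
  complex_computable f -> complex_computable (fun e => - f e).
Proof.
move=> [f1 f2]; split.
  by apply: rational_ext (rational_opp f1) => e; case: (f e).
by apply: rational_ext (rational_opp f2) => e; case: (f e).
Qed.

Lemma complex_mul k (f g : env k -> rat[i]) :
  complex_computable f -> complex_computable g ->
  complex_computable (fun e => f e * g e).
Proof.
move=> [f1 f2] [g1 g2]; split.
  apply: rational_ext (rational_sub (rational_mul f1 g1) (rational_mul f2 g2)).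
  by move=> e; case: (f e) (g e) => a b [].
apply: rational_ext (rational_add (rational_mul f1 g2) (rational_mul f2 g1)).
by move=> e; case: (f e) (g e) => a b [].
Qed.

Lemma complex_exp k (f : env k -> rat[i]) n :
  complex_computable f -> complex_computable (fun e => f e ^+ n).
Proof.
move=> Cf; elim: n => [|n IH].
  by apply: complex_ext (@complex_one k) => e.
by apply: complex_ext (complex_mul Cf IH) => e; rewrite exprS.
Qed.

Lemma complex_muln k (f : env k -> rat[i]) n :
  complex_computable f -> complex_computable (fun e => f e *+ n).
Proof.
move=> Cf; elim: n => [|n IH].
  by apply: complex_ext (@complex_zero k) => e; rewrite mulr0n.
by apply: complex_ext (complex_add Cf IH) => e; rewrite mulrS.
Qed.

Lemma complex_sum k (I : Type) (s : seq I) (F : I -> env k -> rat[i]) :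
  (forall i, complex_computable (F i)) ->
  complex_computable (fun e => \sum_(i <- s) F i e).
Proof.
move=> CF; elim: s => [|i s IH].
  by apply: complex_ext (@complex_zero k) => e; rewrite big_nil.
by apply: complex_ext (complex_add (CF i) IH) => e; rewrite big_cons.
Qed.

(** * The modulus of complex numbers and polynomials on discs *)

Import Order.TTheory GRing.Theory Num.Theory.
Import numFieldNormedType.Exports.
Import ComplexField.Normc.

Local Open Scope ring_scope.

Section Modulus.
Variable R : realType.
Local Notation C := R[i].
Implicit Types (x y z w : C) (p q : {poly C}).

Lemma normc_ge0 z : 0 <= normc z.
Proof. by case: z => a b; apply: sqrtr_ge0. Qed.

Lemma normcE z : `|z| = (normc z)%:C%C.
Proof. by case: z. Qed.

Lemma normcD x y : normc (x + y) <= normc x + normc y.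
Proof. exact: le_normcD. Qed.

Lemma normc_opp x : normc (- x) = normc x.
Proof. exact: normcN. Qed.

Lemma normc_subC x y : normc (x - y) = normc (y - x).
Proof. by rewrite -normc_opp opprB. Qed.

Lemma normc_sub_ge x y : normc x - normc y <= normc (x - y).
Proof. by rewrite lerBlDr -{1}(subrK y x) normcD. Qed.

Lemma normc_le_add x y : normc x <= normc y + normc (x - y).
Proof. by rewrite -{1}(subrK y x) addrC normcD. Qed.

Lemma normc_dist_le x y z : normc (x - z) <= normc (x - y) + normc (y - z).
Proof. by rewrite -{1}(subrK y x) -addrA normcD. Qed.

Lemma normcX x n : normc (x ^+ n) = normc x ^+ n.
Proof.
elim: n => [|n IH]; first by rewrite !expr0; exact: normc1.
by rewrite !exprS normcM IH.
Qed.

Lemma normc_sum (I : Type) (s : seq I) (P : pred I) (F : I -> C) :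
  normc (\sum_(i <- s | P i) F i) <= \sum_(i <- s | P i) normc (F i).
Proof.
elim/big_ind2: _ => [|x1 x2 y1 y2 le1 le2|//]; first by rewrite (normc0 R).
by apply: le_trans (normcD _ _) _; apply: lerD.
Qed.

Lemma normc_prod (I : Type) (s : seq I) (P : pred I) (F : I -> C) :
  normc (\prod_(i <- s | P i) F i) = \prod_(i <- s | P i) normc (F i).
Proof.
by apply: (big_morph (@normc R)) => [x y|]; [apply: normcM | apply: normc1].
Qed.

Lemma normc_real (a : R) : normc a%:C%C = `|a|.
Proof. by rewrite /= expr0n /= addr0 sqrtr_sqr. Qed.

Lemma normc_nat n : normc (n%:R : C) = n%:R.
Proof.
have -> : (n%:R : C) = (n%:R : R)%:C%C by rewrite rmorph_nat.
by rewrite normc_real ger0_norm.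
Qed.

Lemma normcMn x n : normc (x *+ n) = normc x *+ n.
Proof. by rewrite -mulr_natr normcM normc_nat mulr_natr. Qed.

Lemma normc_sqr z : normc z ^+ 2 = complex.Re z ^+ 2 + complex.Im z ^+ 2.
Proof. by case: z => a b /=; rewrite sqr_sqrtr // addr_ge0 ?sqr_ge0. Qed.

Lemma normc_Re z : `|complex.Re z| <= normc z.
Proof.
case: z => a b /=; rewrite -sqrtr_sqr ler_sqrt ?addr_ge0 ?sqr_ge0 //.
by rewrite lerDl sqr_ge0.
Qed.

Lemma normc_Im z : `|complex.Im z| <= normc z.
Proof.
case: z => a b /=; rewrite -sqrtr_sqr ler_sqrt ?addr_ge0 ?sqr_ge0 //.
by rewrite lerDr sqr_ge0.
Qed.

Lemma normc_ReIm z : normc z <= `|complex.Re z| + `|complex.Im z|.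
Proof.
rewrite -(@ler_pXn2r _ 2) ?nnegrE ?normc_ge0 ?addr_ge0 ?normr_ge0 //.
rewrite normc_sqr sqrrD !real_normK ?num_real //.
have := mulr_ge0 (normr_ge0 (complex.Re z)) (normr_ge0 (complex.Im z)).
by lra.
Qed.

Lemma poly_bounded p (r : R) :
  exists2 B : R, 0 < B & forall z, normc z <= r -> normc p.[z] <= B.
Proof.
elim/poly_ind: p => [|p c [B B0 IH]].
  by exists 1 => // z _; rewrite horner0 (normc0 R).
have r0 : 0 <= `|r| by [].
have c0 := normc_ge0 c.
exists (B * `|r| + normc c + 1) => [|z le_z].
  by have := mulr_ge0 (ltW B0) r0; lra.
rewrite !hornerE; apply: le_trans (normcD _ _) _; rewrite normcM.
have := ler_pM (normc_ge0 _) (normc_ge0 _) (IH z le_z) (le_trans le_z (ler_norm r)).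
by lra.
Qed.

(** Along the recursion p X + c, the difference of values splits as
(p(z) - p(w)) z + p(w) (z - w). *)
Lemma poly_lipschitz p (r : R) :
  exists2 L : R, 0 < L & forall z w, normc z <= r -> normc w <= r ->
    normc (p.[z] - p.[w]) <= L * normc (z - w).
Proof.
elim/poly_ind: p => [|p c [L L0 IH]].
  by exists 1 => // z w _ _; rewrite !horner0 subr0 (normc0 R) mul1r normc_ge0.
have [B B0 HB] := poly_bounded p r.
have r0 : 0 <= `|r| by [].
exists (L * `|r| + B) => [|z w le_z le_w].
  by have := mulr_ge0 (ltW L0) r0; lra.
rewrite !hornerE.
have -> : p.[z] * z + c - (p.[w] * w + c) =
  (p.[z] - p.[w]) * z + p.[w] * (z - w) by ring.
apply: le_trans (normcD _ _) _; rewrite !normcM mulrDl.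
apply: lerD; last by rewrite ler_wpM2r ?normc_ge0 // HB.
rewrite mulrAC; apply: ler_pM; rewrite ?normc_ge0 //; first exact: IH.
exact: le_trans le_z (ler_norm r).
Qed.

Lemma poly_taylor p (r : R) :
  exists2 A : R, 0 < A & forall z w, normc z <= r -> normc w <= r ->
    normc (p.[z] - p.[w] - p^`().[w] * (z - w)) <= A * normc (z - w) ^+ 2.
Proof.
elim/poly_ind: p => [|p c [A A0 IH]].
  exists 1 => // z w _ _.
  by rewrite deriv0 !horner0 mul0r !subr0 (normc0 R) mul1r sqr_ge0.
have [B B0 HB] := poly_bounded p^`() r.
have r0 : 0 <= `|r| by [].
exists (A * `|r| + B) => [|z w le_z le_w].
  by have := mulr_ge0 (ltW A0) r0; lra.
have -> : ((p * 'X + c%:P)^`()).[w] = p^`().[w] * w + p.[w].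
  by rewrite derivD derivM derivX derivC !hornerE.
rewrite !hornerMXaddC.
have -> : p.[z] * z + c - (p.[w] * w + c) - (p^`().[w] * w + p.[w]) * (z - w) =
  (p.[z] - p.[w] - p^`().[w] * (z - w)) * z + p^`().[w] * (z - w) ^+ 2 by ring.
rewrite -normcX; have := IH z w le_z le_w; rewrite -normcX.
move: ((z - w) ^+ 2) => v IHv; apply: le_trans (normcD _ _) _.
rewrite !normcM mulrDl.
apply: lerD; last by rewrite ler_wpM2r ?normc_ge0 // HB.
rewrite mulrAC; apply: ler_pM; rewrite ?normc_ge0 //.
exact: le_trans le_z (ler_norm r).
Qed.

Lemma poly_continuous p z (e : R) : 0 < e ->
  exists2 de : R, 0 < de & forall w, normc (w - z) < de ->
    normc (p.[w] - p.[z]) < e.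
Proof.
move=> e0; have [L L0 HL] := poly_lipschitz p (normc z + 1).
exists (Num.min 1 (e / L)); first by rewrite lt_min ltr01 divr_gt0.
move=> w; rewrite lt_min => /andP[lt1 lt2].
apply: le_lt_trans (HL _ _ _ _) _.
- rewrite -{1}(subrK z w); apply: le_trans (normcD _ _) _.
  by rewrite addrC lerD2l ltW.
- by rewrite lerDl.
- by rewrite mulrC -ltr_pdivlMr.
Qed.

(** The modulus of p(z) - y is the product of the distances from z to the
solutions of p(w) = y, so one of these is at most its root of order deg p. *)
Lemma monic_preimage p z y (r : R) : p \is monic -> (1 < size p)%N -> 0 <= r ->
  normc (p.[z] - y) < r ^+ (size p).-1 ->
  exists2 w, p.[w] = y & normc (z - w) < r.
Proof.
move=> mon_p size_p r0 near.
have sC : (size (- y%:P)%R < size p)%N.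
  by rewrite size_polyN (leq_ltn_trans (size_polyC_leq1 _)).
have [rs Ers] := closed_field_poly_normal (p - y%:P).
rewrite lead_coefDl // (monicP mon_p) scale1r in Ers.
have size_rs : size rs = (size p).-1.
  by rewrite -(size_polyDl sC) Ers size_prod_XsubC.
have Hval x : p.[x] - y = \prod_(w <- rs) (x - w).
  rewrite -[y in LHS](hornerC y x) -hornerN -hornerD Ers horner_prod.
  by apply: eq_bigr => w _; rewrite !hornerE.
have [w w_rs lt_w] : exists2 w, w \in rs & normc (z - w) < r.
  apply: contrapT => no; move: near; rewrite ltNge => /negP; apply.
  have far w : w \in rs -> r <= normc (z - w).
    by move=> w_rs; rewrite leNgt; apply/negP => lt_w; apply: no; exists w.
  rewrite Hval normc_prod -size_rs.
  elim: (rs) far => [|w s IH] far; first by rewrite big_nil expr0.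
  rewrite big_cons exprS ler_pM ?exprn_ge0 ?far ?mem_head // IH // => v v_s.
  by rewrite far // inE v_s orbT.
exists w => //; apply/eqP; rewrite -subr_eq0 Hval.
by rewrite (big_rem w) //= subrr mul0r.
Qed.

End Modulus.

(** * Orbits, filled Julia set and Julia set *)

Section Dynamics.
Variables (R : realType) (p : {poly R[i]}).
Local Notation C := R[i].
Implicit Types (z w : C) (n k : nat).

Definition orbit n z : C := iter n (horner p) z.

Definition bounded_orbit z : Prop :=
  exists B : R, forall n, normc (orbit n z) <= B.

Definition multiplier n z : C := \prod_(k < n) p^`().[orbit k z].

Lemma multiplierS n z : multiplier n.+1 z = multiplier n z * p^`().[orbit n z].
Proof. by rewrite /multiplier big_ord_recr. Qed.

Lemma orbitSr n z : orbit n.+1 z = orbit n p.[z].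
Proof. by rewrite /orbit iterSr. Qed.

Lemma orbitD m n z : orbit (m + n) z = orbit m (orbit n z).
Proof. by rewrite /orbit iterD. Qed.

Lemma horner_iterate n z : (iterate p n).[z] = orbit n z.
Proof.
elim: n => [|n IH]; first by rewrite /iterate /= hornerX.
by rewrite /iterate /= horner_comp [(iter _ _ _).[z]]IH.
Qed.

Lemma horner_deriv_iterate n z : ((iterate p n)^`()).[z] = multiplier n z.
Proof.
elim: n => [|n IH]; first by rewrite /iterate /= derivX hornerC /multiplier big_ord0.
rewrite multiplierS -IH.
rewrite -[iterate p n.+1]/(p \Po iterate p n) deriv_comp hornerM mulrC.
by rewrite horner_comp horner_iterate.
Qed.

Lemma filled_juliaP z : filled_julia p z <-> bounded_orbit z.
Proof.
split=> -[B HB]; exists B => n; have := HB n;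
by rewrite horner_iterate normcE lecR.
Qed.

Lemma nbhs_normcP (z : C^o) (A : set C^o) :
  nbhs z A <-> exists2 e : R, 0 < e & forall w : C, normc (w - z) < e -> A w.
Proof.
split.
  move/nbhs_ballP => [e /= e0 sub]; exists (complex.Re e).
    by move: e0; rewrite ltcE /= => /andP[].
  move=> w lt_w; apply: sub; rewrite /ball /= distrC normcE.
  by move: e0 lt_w; case: e => a b; rewrite !ltcE /= => /andP[/eqP-> _] ->; rewrite eqxx.
case=> e e0 sub; apply/nbhs_ballP; exists e%:C%C => /=; first by rewrite ltcR.
move=> w; rewrite /ball /= distrC normcE ltcR; exact: sub.
Qed.

Lemma juliaP z : julia p z <->
  (forall e : R, 0 < e -> exists2 w, normc (w - z) < e & bounded_orbit w) /\
  (forall e : R, 0 < e -> exists2 w, normc (w - z) < e & ~ bounded_orbit w).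
Proof.
split.
  move=> [cl int]; split=> e e0.
    have /cl : nbhs (z : C^o) [set w : C^o | normc ((w : C) - z) < e]%classic.
      by apply/nbhs_normcP; exists e.
    by case=> w [/filled_juliaP bw lt_w]; exists w.
  apply: contrapT => no; apply: int; apply/nbhs_normcP; exists e => // w lt_w.
  by apply/filled_juliaP; apply: contrapT => nb; apply: no; exists w.
case=> cl int; split.
  move=> B /nbhs_normcP [e e0 sub]; have [w lt_w bw] := cl e e0.
  by exists w; split; [apply/filled_juliaP | apply: sub].
move=> /nbhs_normcP [e e0 sub]; have [w lt_w] := int e e0.
by move=> nb; apply: nb; apply/filled_juliaP; apply: sub.
Qed.

Lemma bounded_orbit_step z : bounded_orbit p.[z] <-> bounded_orbit z.
Proof.
split=> -[B HB].
  exists (Num.max B (normc z)) => -[|n]; first by rewrite le_max lexx orbT.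
  by rewrite orbitSr le_max HB.
by exists B => n; rewrite -orbitSr.
Qed.

Lemma orbit_continuous n z (e : R) : 0 < e ->
  exists2 de : R, 0 < de & forall w, normc (w - z) < de ->
    normc (orbit n w - orbit n z) < e.
Proof.
move=> e0; have [de de0 Hde] := poly_continuous (iterate p n) z e0.
by exists de => // w /Hde; rewrite !horner_iterate.
Qed.

(** Where the modulus doubles, it goes on doubling; so [S] separates bounded from
unbounded orbits. *)
Definition escape_radius (S : R) : Prop :=
  1 <= S /\ forall z, S <= normc z -> 2 * normc z <= normc p.[z].

Variable S : R.
Hypothesis escS : escape_radius S.

Lemma escape_growth z n : S <= normc z -> 2 ^+ n <= normc (orbit n z).
Proof.
case: escS => S1 grow le_z.
suff : 2 ^+ n <= normc (orbit n z) /\ S <= normc (orbit n z) by case.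
elim: n => [|n [IH1 IH2]]; first by rewrite expr0 (le_trans S1).
rewrite -[orbit n.+1 z]/(p.[orbit n z]) exprS; have := grow _ IH2.
have : 0 <= normc (orbit n z) by apply: normc_ge0.
by split; lra.
Qed.

Lemma bounded_orbitP z : bounded_orbit z <-> forall n, normc (orbit n z) < S.
Proof.
split=> [[B HB] n|lt_S]; last by exists S => n; apply: ltW.
rewrite ltNge; apply/negP => le_S.
have [m lt_m] : exists m : nat, B < m%:R.
  by exists (Num.bound `|B|); apply: le_lt_trans (ler_norm B) (archi_boundP _).
have := HB (m + n); rewrite orbitD => le_B.
have := escape_growth m le_S; suff : m%:R <= 2 ^+ m :> R by lra.
by rewrite -natrX ler_nat ltnW // ltn_expl.
Qed.

Lemma bounded_orbit_lt z : bounded_orbit z -> normc z < S.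
Proof. by move/bounded_orbitP => /(_ 0). Qed.

(** Leaving the disc of radius 2S at some time is an open condition. *)
Lemma unbounded_orbit_open z : ~ bounded_orbit z ->
  exists2 e : R, 0 < e & forall w, normc (w - z) < e -> ~ bounded_orbit w.
Proof.
move=> nb; have [n le_n] : exists n, 2 * S <= normc (orbit n z).
  have [S1 grow] := escS.
  have [n le_n] : exists n, S <= normc (orbit n z).
    apply: contrapT => no; apply: nb; apply/bounded_orbitP => n.
    by rewrite ltNge; apply/negP => le_n; apply: no; exists n.
  by exists n.+1; apply: le_trans (grow _ le_n); rewrite ler_pM2l.
have S0 : 0 < S by case: escS => S1 _; lra.
have [de de0 Hde] := orbit_continuous n z S0.
exists de => // w /Hde lt_w /bounded_orbitP /(_ n).
have := normc_sub_ge (orbit n z) (orbit n w); rewrite normc_subC.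
by lra.
Qed.

Lemma julia_bounded z : julia p z -> bounded_orbit z.
Proof.
move/juliaP => [cl _]; apply: contrapT => /unbounded_orbit_open [e e0 far].
by have [w /far] := cl e e0.
Qed.

Lemma julia_near_unbounded z (e : R) : julia p z -> 0 < e ->
  exists2 w, normc (w - z) < e & ~ bounded_orbit w.
Proof. by move=> /juliaP [_]; apply. Qed.

Lemma juliaI z : bounded_orbit z ->
  (forall e : R, 0 < e -> exists2 w, normc (w - z) < e & ~ bounded_orbit w) ->
  julia p z.
Proof.
move=> bz nb; apply/juliaP; split=> // e e0; exists z => //.
by rewrite subrr (normc0 R).
Qed.

Lemma julia_image z : julia p z -> julia p p.[z].
Proof.
move=> Jz; apply: juliaI; first by apply/bounded_orbit_step; apply: julia_bounded.
move=> e e0; have [de de0 Hde] := poly_continuous p z e0.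
have [w lt_w nb] := julia_near_unbounded Jz de0.
by exists p.[w]; [apply: Hde | rewrite bounded_orbit_step].
Qed.

Lemma julia_orbit z n : julia p z -> julia p (orbit n z).
Proof. by move=> Jz; elim: n => [|n IH]; [exact: Jz | exact: julia_image IH]. Qed.

Hypotheses (mon_p : p \is monic) (size_p : (1 < size p)%N).

(** Polynomials are open: an unbounded orbit that starts near p(z) has a preimage
near z. *)
Lemma julia_preimage z : julia p p.[z] -> julia p z.
Proof.
move=> Jz; apply: juliaI; first by apply/bounded_orbit_step; apply: julia_bounded.
move=> e e0; have ed0 : 0 < e ^+ (size p).-1 by rewrite exprn_gt0.
have [y lt_y nb] := julia_near_unbounded Jz ed0.
rewrite normc_subC in lt_y.
have [w Ew lt_w] := monic_preimage mon_p size_p (ltW e0) lt_y.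
by exists w; rewrite 1?normc_subC // -bounded_orbit_step Ew.
Qed.

(** The last point of the segment with bounded orbit exists, because such points
form a closed set, and it is a boundary point. *)
Lemma julia_between z w : bounded_orbit z -> ~ bounded_orbit w ->
  exists2 v : C, julia p v & normc (v - z) <= normc (w - z).
Proof.
move=> bz nbw.
pose pt (t : R) : C := z + t%:C%C * (w - z).
have ptB s t : normc (pt s - pt t) = `|s - t| * normc (w - z).
  rewrite -normc_real -normcM; congr normc.
  by rewrite rmorphB /pt; ring.
pose A : set R := [set t | 0 <= t <= 1 /\ bounded_orbit (pt t)]%classic.
have A0 : A 0.
  by split; rewrite ?lexx ?ler01 // /pt mul0r addr0.
have ubA : ubound A 1 by move=> t [/andP[]].
have supA : has_sup A by split; [exists 0 | exists 1].
pose s := sup A.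
have s01 : 0 <= s <= 1.
  by apply/andP; split; [apply: ub_le_sup => //; exists 1 | apply: ge_sup => //; exists 0].
have nzw : 0 < normc (w - z).
  rewrite lt_neqAle normc_ge0 andbT eq_sym; apply/eqP => /eq0_normc /eqP.
  by rewrite subr_eq0 => /eqP E; apply: nbw; rewrite E.
have bs : bounded_orbit (pt s).
  apply: contrapT => /unbounded_orbit_open [e e0 far].
  have e'0 : 0 < e / normc (w - z) by apply: divr_gt0.
  have [t At lt_t] := sup_adherent e'0 supA.
  have le_t : t <= s by apply: ub_le_sup => //; exists 1.
  case: At => _; apply: far; rewrite ptB -ltr_pdivlMr //.
  rewrite -/s in lt_t; rewrite ler0_norm; lra.
exists (pt s); last first.
  rewrite -[leRHS]mul1r -{1}[z](_ : pt 0 = z); last by rewrite /pt mul0r addr0.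
  by rewrite ptB subr0 ler_wpM2r ?normc_ge0 // ger0_norm; lra.
apply: juliaI => // e e0.
have [s1|s1] := eqVneq s 1.
  by case: nbw; move: bs; rewrite s1 /pt mul1r addrC subrK.
pose t := Num.min 1 (s + e / (2 * normc (w - z))).
have st : s < t.
  by rewrite lt_min ltrDl divr_gt0 ?mulr_gt0 // lt_neqAle s1 /=; lra.
exists (pt t).
  rewrite ptB -ltr_pdivlMr // gtr0_norm ?subr_gt0 // ltrBlDl.
  apply: le_lt_trans (_ : t <= s + e / (2 * normc (w - z))) _.
    by rewrite ge_min lexx orbT.
  rewrite ltrD2l ltr_pM2l // ltf_pV2 ?posrE ?mulr_gt0 //; lra.
move=> bt; suff : t <= s by lra.
apply: ub_le_sup; first by exists 1.
split=> //; apply/andP; split; first by lra.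
by rewrite /t ge_min lexx.
Qed.

End Dynamics.

(** * Certificates on a grid and their soundness *)

Section Grid.
Variables (R : realType) (N S : nat).
Local Notation C := R[i].
Local Notation side := (2 * S * N)%N.

Definition grid_point (u v : nat) : C :=
  ((u%:R / N%:R - S%:R) +i* (v%:R / N%:R - S%:R))%C.

(** Ranks: 2 and more for escaping points, counting down along an orbit; 1 for
points of a trap, whose images stay in the disc of radius [S] even after an
error [k]; 0 for points near the Julia set. There the density is [weight + 1],
and the density at the image times the derivative, diminished by the margin
[k], exceeds the density at the point by at least 1. *)
Definition certificate (p : {poly C}) (k : R) (rank weight : nat -> nat -> nat) :
    Prop :=
  (forall u v, (u <= side)%N -> (v <= side)%N -> rank u v = 1%N ->
     normc p.[grid_point u v] + k <= S%:R) /\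
  (forall u v u' v', (u <= side)%N -> (v <= side)%N ->
     (u' <= side)%N -> (v' <= side)%N ->
     normc (p.[grid_point u v] - grid_point u' v') <= k ->
     [/\ (1 < rank u v)%N -> (1 < rank u' v' < rank u v)%N,
         rank u v = 1%N -> rank u' v' = 1%N &
         rank u v = 0%N -> rank u' v' = 0%N ->
         (weight u v).+2%:R + (weight u' v').+1%:R * k <=
         normc p^`().[grid_point u v] * (weight u' v').+1%:R]).

Hypothesis N_gt0 : (0 < N)%N.
Let N0 : 0 < N%:R :> R. Proof. by rewrite ltr0n. Qed.

Lemma grid_coordinate (a : R) : `|a| <= S%:R ->
  exists2 u, (u <= side)%N & `|a - (u%:R / N%:R - S%:R)| <= N%:R^-1.
Proof.
rewrite ler_norml => /andP[ge_a le_a].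
have b0 : 0 <= (a + S%:R) * N%:R by rewrite mulr_ge0 ?ler0n //; lra.
have /andP[le_u lt_u] := truncn_itv b0; set u := Num.trunc _ in le_u lt_u.
exists u.
  rewrite -(ler_nat R); apply: le_trans le_u _.
  by rewrite !natrM ler_wpM2r ?ler0n //; lra.
have -> : a - (u%:R / N%:R - S%:R) = ((a + S%:R) * N%:R - u%:R) / N%:R.
  by field; rewrite gt_eqF.
rewrite ger0_norm ?divr_ge0 ?subr_ge0 ?ler0n //.
by rewrite -[leRHS]mul1r ler_wpM2r ?invr_ge0 ?ler0n // lerBlDl natr1 ltW.
Qed.

Lemma grid_near (z : C) : `|complex.Re z| <= S%:R -> `|complex.Im z| <= S%:R ->
  exists u v, [/\ (u <= side)%N, (v <= side)%N &
    normc (z - grid_point u v) <= 2 / N%:R].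
Proof.
move=> /grid_coordinate [u le_u near_u] /grid_coordinate [v le_v near_v].
exists u, v; split=> //; apply: le_trans (normc_ReIm _) _.
by case: z near_u near_v => a b /=; lra.
Qed.

Lemma grid_point_bound u v : (u <= side)%N -> (v <= side)%N ->
  normc (grid_point u v) <= 2 * S%:R.
Proof.
have bnd w : (w <= side)%N -> `|w%:R / N%:R - S%:R| <= S%:R :> R.
  rewrite -(ler_nat R) !natrM => le_w; rewrite ler_norml.
  have : w%:R / N%:R <= 2 * S%:R :> R by rewrite ler_pdivrMr.
  have : 0 <= w%:R / N%:R :> R by rewrite divr_ge0 ?ler0n.
  by lra.
move=> /bnd le_u /bnd le_v; apply: le_trans (normc_ReIm _) _ => /=; lra.
Qed.

End Grid.

Section Soundness.
Variables (R : realType) (N S : nat) (p q : {poly R[i]}) (k : R).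
Variables (rank weight : nat -> nat -> nat).
Local Notation C := R[i].
Local Notation side := (2 * S * N)%N.
Local Notation point := (grid_point R N S).
Hypothesis N_gt0 : (0 < N)%N.
Hypothesis esc : escape_radius q S%:R.
Hypothesis cert : certificate N S p k rank weight.
Hypothesis approx : forall u v (z : C), (u <= side)%N -> (v <= side)%N ->
  normc (z - point u v) <= 3 / N%:R ->
  normc (q.[z] - p.[point u v]) + 2 / N%:R <= k /\
  normc (q^`().[z] - p^`().[point u v]) <= k.

Let N0 : 0 < N%:R :> R. Proof. by rewrite ltr0n. Qed.
Let iN0 : 0 < N%:R^-1 :> R. Proof. by rewrite invr_gt0. Qed.

Definition cell (z : C) (u v : nat) : Prop :=
  [/\ (u <= side)%N, (v <= side)%N & normc (z - point u v) <= 2 / N%:R].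

Lemma bounded_cell z : bounded_orbit q z -> exists u v, cell z u v.
Proof.
move=> /(bounded_orbit_lt esc) lt_z.
apply: grid_near; first exact: N_gt0.
  exact: le_trans (normc_Re z) (ltW lt_z).
exact: le_trans (normc_Im z) (ltW lt_z).
Qed.

Lemma cell_transition z u v u' v' : (u <= side)%N -> (v <= side)%N ->
  normc (z - point u v) <= 3 / N%:R -> cell q.[z] u' v' ->
  normc (p.[point u v] - point u' v') <= k.
Proof.
move=> le_u le_v near [_ _ near'].
have [close _] := approx le_u le_v near.
apply: le_trans (normc_dist_le _ q.[z] _) _.
by rewrite (normc_subC p.[_]); lra.
Qed.

Lemma cell_near3 z u v : cell z u v -> normc (z - point u v) <= 3 / N%:R.
Proof. by case=> _ _ near; have := iN0; lra. Qed.

(** The rank cannot decrease forever. *)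
Lemma escaping_cell_unbounded z u v : cell z u v -> (1 < rank u v)%N ->
  ~ bounded_orbit q z.
Proof.
have [n] := ubnP (rank u v); elim: n z u v => // n IH z u v le_n cz gt1.
rewrite -bounded_orbit_step => bz.
have [u' [v' cz']] := bounded_cell bz.
have [le_u le_v _] := cz; have [le_u' le_v' _] := cz'.
have tr := cell_transition le_u le_v (cell_near3 cz) cz'.
have [/(_ gt1)/andP[gt1' lt_r] _ _] := cert.2 _ _ _ _ le_u le_v le_u' le_v' tr.
by apply: (IH q.[z] u' v') bz => //; apply: leq_trans lt_r _.
Qed.

(** Cells have radius 2/N, and the trap consists of discs of radius 3/N: thus
every trapped cell has a neighbourhood inside the trap. *)
Lemma trapped_cell_bounded z u v : (u <= side)%N -> (v <= side)%N ->
  normc (z - point u v) <= 3 / N%:R -> rank u v = 1%N -> bounded_orbit q z.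
Proof.
move=> le_u le_v near r1; exists (2 * S%:R + 3 / N%:R) => n.
elim: n z u v le_u le_v near r1 => [|n IH] z u v le_u le_v near r1.
  have := grid_point_bound R N_gt0 le_u le_v.
  by have := normc_sub_ge z (point u v); rewrite /orbit /=; lra.
have [close _] := approx le_u le_v near.
have bnd := cert.1 _ _ le_u le_v r1.
have le_qz : normc q.[z] <= S%:R.
  have := normc_sub_ge q.[z] p.[point u v].
  by have := iN0; lra.
have [u' [v' [le_u' le_v' near']]] :=
  grid_near N_gt0 (le_trans (normc_Re _) le_qz) (le_trans (normc_Im _) le_qz).
have tr := cell_transition le_u le_v near (And3 le_u' le_v' near').
have [_ /(_ r1) r1' _] := cert.2 _ _ _ _ le_u le_v le_u' le_v' tr.
by rewrite orbitSr; apply: (IH _ u' v') => //; have := iN0; lra.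
Qed.

Lemma julia_rank0 (z : C) u v : julia q z -> cell z u v -> rank u v = 0%N.
Proof.
move=> Jz cz; case Er: (rank u v) => [//|[|r]].
  have [w lt_w] := julia_near_unbounded Jz iN0; case.
  have [le_u le_v near] := cz.
  apply: (trapped_cell_bounded le_u le_v) => //.
  by apply: le_trans (normc_dist_le _ z _) _; have := iN0; lra.
case: (escaping_cell_unbounded cz); first by rewrite Er.
exact (julia_bounded esc Jz).
Qed.

(** On the Julia set only rank 0 occurs, and a gain of 1 on a density that is at
most B is a factor of at least 1 + 1/B. *)
Theorem certificate_hyperbolic : hyperbolic q.
Proof.
pose B : R := \sum_(u < side.+1) \sum_(v < side.+1) (weight u v).+1%:R.
have wB u v : (u <= side)%N -> (v <= side)%N -> (weight u v).+1%:R <= B.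
  rewrite -ltnS -[(v <= _)%N]ltnS => lt_u lt_v; rewrite /B (bigD1 (Ordinal lt_u)) //=.
  rewrite (bigD1 (Ordinal lt_v)) //= -addrA lerDl.
  by rewrite addr_ge0 ?sumr_ge0 // => i _; rewrite ?sumr_ge0.
have B1 : 1 <= B by apply: le_trans (wB 0%N 0%N _ _) => //; rewrite ler1n.
have B0 : 0 < B by lra.
exists B^-1, (1 + B^-1); split; rewrite ?invr_gt0 ?ltrDl ?invr_gt0 //.
move=> z Jz n; rewrite horner_deriv_iterate normcE lecR.
have cells j : exists uv : nat * nat, cell (orbit q j z) uv.1 uv.2.
  by have [u [v c]] := bounded_cell (julia_bounded esc (julia_orbit esc j Jz)); exists (u, v).
have [f cf] := choice cells.
pose W j : R := (weight (f j).1 (f j).2).+1%:R.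
have W1 j : 1 <= W j by rewrite ler1n.
have WB j : W j <= B by have [le_u le_v _] := cf j; apply: wB.
have expand j : W j + 1 <= normc q^`().[orbit q j z] * W j.+1.
  have [le_u le_v near] := cf j; have [le_u' le_v' near'] := cf j.+1.
  have tr := cell_transition le_u le_v (cell_near3 (cf j)) (cf j.+1).
  have [_ _ exp] := cert.2 _ _ _ _ le_u le_v le_u' le_v' tr.
  have {exp} exp := exp (julia_rank0 (julia_orbit esc j Jz) (cf j))
    (julia_rank0 (julia_orbit esc j.+1 Jz) (cf j.+1)).
  have [_ close] := approx le_u le_v (cell_near3 (cf j)).
  have {}exp : W j + 1 + W j.+1 * k <=
      normc p^`().[point (f j).1 (f j).2] * W j.+1.
    by move: exp; rewrite -[_.+2%:R]natr1.
  have := normc_sub_ge p^`().[point (f j).1 (f j).2] q^`().[orbit q j z].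
  rewrite normc_subC => le_d.
  have : (normc p^`().[point (f j).1 (f j).2] - k) * W j.+1 <=
     normc q^`().[orbit q j z] * W j.+1.
    by rewrite ler_wpM2r //; lra.
  by lra.
have grow j : (1 + B^-1) ^+ j <= normc (multiplier q j z) * W j.
  elim: j => [|j IH]; first by rewrite expr0 /multiplier big_ord0 (normc1 R) mul1r.
  rewrite exprSr multiplierS normcM -mulrA.
  have m0 := normc_ge0 (multiplier q j z).
  apply: le_trans (_ : normc (multiplier q j z) * (W j + 1) <= _); last first.
    by rewrite ler_wpM2l.
  apply: le_trans (_ : normc (multiplier q j z) * W j * (1 + B^-1) <= _).
    by rewrite ler_wpM2r // addr_ge0 ?invr_ge0 // ltW.
  rewrite -mulrA ler_wpM2l // mulrDr mulr1 lerD2l.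
  by rewrite ler_pdivrMr // mul1r.
rewrite ler_pdivrMl // mulrC; apply: le_trans (grow n) _.
by rewrite ler_wpM2l ?normc_ge0.
Qed.

End Soundness.

(** * The expanding metric of a hyperbolic polynomial *)

Section Compactness.
Local Open Scope classical_set_scope.
Variable R : realType.
Local Notation C := R[i].

(** Bolzano-Weierstrass, from the compactness of a square in R * R. *)
Lemma bounded_cluster (u : nat -> C) (r : R) : (forall n, normc (u n) <= r) ->
  exists z : C, forall e : R, 0 < e -> forall n,
    exists2 k, (n <= k)%N & normc (u k - z) < e.
Proof.
move=> le_u; pose v n : R * R := (complex.Re (u n), complex.Im (u n)).
have cpt : compact (`[- r, r] `*` `[- r, r] : set (R * R)).
  by apply: compact_setX; apply: segment_compact.
have inA : (v @ \oo) (`[- r, r] `*` `[- r, r]).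
  exists 0%N => // n _; split; rewrite /= in_itv /= -ler_norml;
  apply: le_trans (le_u n); [exact: normc_Re | exact: normc_Im].
have [[a b] [_ clu]] := cpt (v @ \oo) _ inA.
exists (a +i* b)%C => e e0 n.
have tail : (v @ \oo) [set v k | k in [set k | (n <= k)%N]].
  by exists n => // k /= le_k; exists k.
have near_ab : nbhs (a, b) [set x : R * R | `|x.1 - a| < e / 2 /\ `|x.2 - b| < e / 2].
  apply/nbhs_ballP; exists (e / 2) => /=; first by rewrite divr_gt0.
  by move=> [x y] [/= ]; rewrite /ball /= distrC (distrC b).
have [_ [[k le_k <-] [/= lt_a lt_b]]] := clu _ _ tail near_ab.
exists k => //; apply: le_lt_trans (normc_ReIm _) _.
by move: lt_a lt_b; case: (u k) => x y /=; lra.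
Qed.

Lemma unbounded_powers (L B : R) : 1 < L -> exists n, B <= L ^+ n.
Proof.
move=> L1; have bern n : 1 + (L - 1) *+ n <= L ^+ n.
  elim: n => [|n IH]; first by rewrite mulr0n addr0 expr0.
  rewrite exprS mulrS; have : 0 <= (L - 1) *+ n by rewrite mulrn_wge0; lra.
  move: ((L - 1) *+ n) (L ^+ n) IH => x y le_xy x0.
  by have := mulr_ge0 (ltW (lt_trans ltr01 L1)) x0; nra.
have L0 : 0 < L - 1 by lra.
exists (Num.bound (`|B| / (L - 1))); apply: le_trans (bern _).
have := archi_boundP (divr_ge0 (normr_ge0 B) (ltW L0)).
rewrite ltr_pdivrMr // mulrC mulr_natr => lt_B.
by have := ler_norm B; lra.
Qed.

End Compactness.

Section ExpandingMetric.
Variables (R : realType) (p : {poly R[i]}) (S : R).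
Local Notation C := R[i].
Hypothesis escS : escape_radius p S.

Lemma multiplierSr n z : multiplier p n.+1 z = p^`().[z] * multiplier p n p.[z].
Proof.
rewrite /multiplier big_ord_recl; congr (_ * _).
by apply: eq_bigr => k _; rewrite -orbitSr.
Qed.

Lemma expanding_power : hyperbolic p ->
  exists2 n, (0 < n)%N & forall z : C, julia p z -> 2 <= normc (multiplier p n z).
Proof.
move=> [c [L [c0 L1 exp]]].
have [n le_n] := unbounded_powers (2 / c) L1.
exists n.+1 => // z Jz; have := exp z Jz n.+1.
rewrite horner_deriv_iterate normcE lecR; apply: le_trans.
rewrite -ler_pdivrMl // mulrC; apply: le_trans le_n _.
by rewrite exprS ler_peMl ?exprn_ge0 //; lra.
Qed.

Variable n : nat.
Hypothesis n_gt0 : (0 < n)%N.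

(** The density of an adapted metric: it turns expansion by the n-th iterate
into expansion by the first one. *)
Definition density (z : C) : R := \sum_(k < n) normc (multiplier p k z).

Lemma density_ge1 z : 1 <= density z.
Proof.
rewrite /density; case: n n_gt0 => // m _.
rewrite big_ord_recl {1}/multiplier big_ord0 (normc1 R) lerDl.
by rewrite sumr_ge0 // => k _; apply: normc_ge0.
Qed.

(** By the chain rule, applying p shifts the sum by one term. *)
Lemma density_image z : normc p^`().[z] * density p.[z] =
  density z - 1 + normc (multiplier p n z).
Proof.
rewrite /density mulr_sumr.
transitivity (\sum_(k < n) normc (multiplier p k.+1 z)).
  by apply: eq_bigr => k _; rewrite -normcM multiplierSr.
have := erefl (\sum_(k < n.+1) normc (multiplier p k z)).
rewrite {1}big_ord_recl big_ord_recr /= {1}/multiplier big_ord0 (normc1 R) => E.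
by apply: (addrI 1); rewrite [LHS]E; ring.
Qed.

Lemma density_bounded (r : R) :
  exists2 B : R, 1 <= B & forall z, normc z <= r -> density z <= B.
Proof.
rewrite /density; elim: (n) => [|m [B B1 HB]].
  by exists 1 => // z _; rewrite big_ord0 ler01.
have [B' B'0 HB'] := poly_bounded (iterate p m)^`() r.
exists (B + B') => [|z le_z]; first by lra.
rewrite big_ord_recr /= lerD ?HB //.
by rewrite -horner_deriv_iterate HB'.
Qed.

Lemma density_lipschitz (r : R) : exists2 L : R, 0 < L &
  forall z w, normc z <= r -> normc w <= r ->
    `|density z - density w| <= L * normc (z - w).
Proof.
rewrite /density; elim: (n) => [|m [L L0 HL]].
  exists 1 => // z w _ _.
  by rewrite !big_ord0 subrr normr0 mul1r normc_ge0.
have [L' L'0 HL'] := poly_lipschitz (iterate p m)^`() r.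
exists (L + L') => [|z w le_z le_w]; first by lra.
rewrite !big_ord_recr /= opprD addrACA mulrDl.
apply: le_trans (ler_normD _ _) _; apply: lerD; first exact: HL.
apply: le_trans (HL' _ _ le_z le_w); rewrite !horner_deriv_iterate ler_norml.
have := normc_sub_ge (multiplier p m z) (multiplier p m w).
have := normc_sub_ge (multiplier p m w) (multiplier p m z).
by rewrite normc_subC => h1 h2; apply/andP; split; lra.
Qed.

Hypothesis exp_n : forall z : C, julia p z -> 2 <= normc (multiplier p n z).

Lemma density_expanding (z : C) : julia p z ->
  density z + 1 <= normc p^`().[z] * density p.[z].
Proof. by move=> /exp_n; rewrite density_image; lra. Qed.

(** Lipschitz bounds carry over the inequality on the Julia set, half of the
gain being spent on the errors. *)
Lemma density_expanding_near : exists2 de : R, 0 < de & exists2 s : R, 0 < s &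
  forall z z' w : C, julia p w -> normc (z - w) <= de -> normc (z' - p.[z]) <= s ->
    density z + 2^-1 <= normc p^`().[z] * density z'.
Proof.
have [Lp Lp0 HLp] := poly_lipschitz p (S + 1).
have [Ld Ld0 HLd] := poly_lipschitz p^`() (S + 1).
have [Bd Bd0 HBd] := poly_bounded p^`() (S + 1).
have [Lr Lr0 HLr] := density_lipschitz (S + 1).
have [Br Br1 HBr] := density_bounded (S + 1).
have Br0 : 0 < Br by lra.
(* [M * de] bounds the effect of moving [z] to [w], and [Bd * Lr * s] that of
   moving [p.[z]] to [z']. *)
pose M := Bd * Lr * Lp + Ld * Br + Lr.
have M0 : 0 < M by rewrite /M !addr_gt0 ?mulr_gt0.
pose de := Num.min (4 * M)^-1 (Num.min 1 (2 * Lp)^-1).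
pose s := Num.min (4 * (Bd * Lr))^-1 2^-1.
have de0 : 0 < de by rewrite /de !lt_min ltr01 !invr_gt0 !mulr_gt0.
have s0 : 0 < s by rewrite /s lt_min !invr_gt0 mulr_gt0 ?mulr_gt0 //= ltr0n.
have de1 : de <= 1 by rewrite /de !ge_min lexx /= orbT.
have deM : M * de <= 4^-1.
  apply: le_trans (_ : M * (4 * M)^-1 <= _).
    by rewrite ler_pM2l // /de ge_min lexx.
  by rewrite invfM mulrCA divff ?mulr1 // gt_eqF.
have deL : Lp * de <= 2^-1.
  apply: le_trans (_ : Lp * (2 * Lp)^-1 <= _).
    by rewrite ler_pM2l // /de !ge_min lexx /= !orbT.
  by rewrite invfM mulrCA divff ?mulr1 // gt_eqF.
have sB : Bd * Lr * s <= 4^-1.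
  apply: le_trans (_ : Bd * Lr * (4 * (Bd * Lr))^-1 <= _).
    by rewrite ler_pM2l ?mulr_gt0 // /s ge_min lexx.
  by rewrite invfM mulrCA divff ?mulr1 // gt_eqF ?mulr_gt0.
have s2 : s <= 2^-1 by rewrite /s ge_min lexx orbT.
exists de => //; exists s => // z z' w Jw near near'.
have lt_w := bounded_orbit_lt escS (julia_bounded escS Jw).
have lt_pw := bounded_orbit_lt escS (julia_bounded escS (julia_image escS Jw)).
have le_w : normc w <= S + 1 by lra.
have le_z : normc z <= S + 1 by have := normc_sub_ge z w; lra.
have near_p : normc (p.[z] - p.[w]) <= Lp * de.
  by apply: le_trans (HLp _ _ le_z le_w) _; rewrite ler_pM2l.
have near_z' : normc (z' - p.[w]) <= s + Lp * de.
  by apply: le_trans (normc_dist_le _ p.[z] _) _; apply: lerD.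
have le_pw : normc p.[w] <= S + 1 by lra.
have le_z' : normc z' <= S + 1 by have := normc_sub_ge z' p.[w]; lra.
have D1 : normc p^`().[w] - Ld * de <= normc p^`().[z].
  have h2 := normc_sub_ge p^`().[w] p^`().[z].
  have h1 := HLd _ _ le_w le_z; rewrite (normc_subC w) in h1.
  have : Ld * normc (z - w) <= Ld * de by rewrite ler_pM2l.
  by lra.
have D2 : density p.[w] - Lr * (s + Lp * de) <= density z'.
  have := HLr _ _ le_z' le_pw; rewrite ler_norml => /andP[h _].
  have : Lr * normc (z' - p.[w]) <= Lr * (s + Lp * de) by rewrite ler_pM2l.
  by lra.
have D3 : density z <= density w + Lr * de.
  have := HLr _ _ le_z le_w; rewrite ler_norml => /andP[_ h].
  have : Lr * normc (z - w) <= Lr * de by rewrite ler_pM2l.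
  by lra.
have D4 := density_expanding Jw.
have D5 := density_ge1 z'; have D6 := HBr _ le_z'.
have D7 := HBd _ le_w; have D8 := normc_ge0 p^`().[w].
have E1 : (normc p^`().[w] - Ld * de) * density z' <=
    normc p^`().[z] * density z' by rewrite ler_wpM2r //; lra.
have E2 : Ld * de * density z' <= Ld * de * Br.
  by rewrite ler_wpM2l // mulr_ge0 // ltW.
have E3 : normc p^`().[w] * (density p.[w] - Lr * (s + Lp * de)) <=
    normc p^`().[w] * density z' by rewrite ler_wpM2l.
have E4 : normc p^`().[w] * (Lr * (s + Lp * de)) <= Bd * (Lr * (s + Lp * de)).
  by rewrite ler_wpM2r // mulr_ge0 ?addr_ge0 ?mulr_ge0 // ltW.
by rewrite /M in deM; lra.
Qed.

(** Bounded orbits that start away from the Julia set, where the distance to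
[w] is measured with the density at [w]. *)
Definition trapped (e : R) (z : C) : Prop :=
  bounded_orbit p z /\
  forall w : C, julia p w -> e <= normc (z - w) * density w.

Hypotheses (mon_p : p \is monic) (size_p : (1 < size p)%N).

(** If p(z) were at distance less than (1 + ka) e from w' in the Julia set, then
z would be close to some preimage w of w', which is in the Julia set as well.
Near w the map multiplies distances by almost |p'(w)|, so the expansion of the
density brings z closer to w than e. This leaves room for an error in p(z), and
an error that small cannot lead to an unbounded orbit, because the segment
would cross the Julia set. *)
Lemma trap_invariant (e1 : R) : 0 < e1 -> exists2 e : R, 0 < e <= e1 &
  exists2 s : R, 0 < s &
  forall z z', trapped e z -> normc (z' - p.[z]) <= s -> trapped e z'.
Proof.
move=> e10; have [A A0 HA] := poly_taylor p S.
have [B B1 HB] := density_bounded S.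
have JB (w : C) : julia p w -> density w <= B.
  by move=> /(julia_bounded escS)/(bounded_orbit_lt escS) lt_w; apply/HB/ltW.
have B0 : 0 < B by lra.
(* Within [r] of [w], the quadratic term costs at most half of the gain
   ([ArB]); the other half amounts to the factor [1 + ka] ([kaB]). *)
pose r := (2 * A * B)^-1; pose ka := (2 * B)^-1.
have r0 : 0 < r by rewrite invr_gt0 !mulr_gt0.
have ka0 : 0 < ka by rewrite invr_gt0 mulr_gt0.
have kaB : ka * B = 2^-1 by rewrite /ka; field; rewrite gt_eqF.
have ArB : A * r * B = 2^-1.
  by rewrite /r; field; rewrite !gt_eqF.
have ka1 : ka <= 1 by nra.
pose e := Num.min e1 (r ^+ (size p).-1 / 4).
have e0 : 0 < e by rewrite lt_min e10 divr_gt0 ?exprn_gt0.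
have e_r : 4 * e <= r ^+ (size p).-1.
  have : e <= r ^+ (size p).-1 / 4 by rewrite ge_min lexx orbT.
  by lra.
have s0 : 0 < ka * e / B / 2 by rewrite !divr_gt0 ?mulr_gt0.
exists e; first by rewrite e0 ge_min lexx.
exists (ka * e / B / 2) => // z z' [bz far] near.
have sB : normc (z' - p.[z]) * B <= ka * e / 2.
  rewrite -ler_pdivlMr //; apply: le_trans near _.
  by rewrite mulrAC.
have image_far (w' : C) : julia p w' ->
    (1 + ka) * e <= normc (p.[z] - w') * density w'.
  move=> Jw'; rewrite leNgt; apply/negP => lt_w'.
  have rho1 := density_ge1 w'.
  have lt2 : normc (p.[z] - w') < r ^+ (size p).-1.
    have : normc (p.[z] - w') <= normc (p.[z] - w') * density w'.
      by rewrite ler_peMr ?normc_ge0.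
    have : ka * e <= e by rewrite ler_piMl // ltW.
    by lra.
  have [w Ew lt_w] := monic_preimage mon_p size_p (ltW r0) lt2.
  subst w'.
  have Jw : julia p w by exact (julia_preimage escS mon_p size_p Jw').
  have le_w := ltW (bounded_orbit_lt escS (julia_bounded escS Jw)).
  have le_z := ltW (bounded_orbit_lt escS bz).
  have tay := HA _ _ le_z le_w.
  have D0 := normc_ge0 (z - w).
  have low : (normc p^`().[w] - A * r) * normc (z - w) <= normc (p.[z] - p.[w]).
    have := normc_sub_ge (p^`().[w] * (z - w)) (p.[z] - p.[w]).
    rewrite normc_subC normcM => h.
    have : A * normc (z - w) ^+ 2 <= A * r * normc (z - w).
      by rewrite -mulrA ler_pM2l // expr2 ler_wpM2r // ltW.
    by lra.
  have low2 : (normc p^`().[w] - A * r) * normc (z - w) * density p.[w] <=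
      normc (p.[z] - p.[w]) * density p.[w].
    by rewrite ler_wpM2r //; lra.
  have ex : (density w + 2^-1) * normc (z - w) <=
     (normc p^`().[w] * density p.[w] - A * r * density p.[w]) * normc (z - w).
    rewrite ler_wpM2r // lerBrDr.
    have := density_expanding Jw.
    have : A * r * density p.[w] <= A * r * B.
      rewrite ler_pM2l ?mulr_gt0 //.
      exact (JB _ Jw').
    by lra.
  have fin : (1 + ka) * e <= (density w + 2^-1) * normc (z - w).
    apply: le_trans (_ : (1 + ka) * (normc (z - w) * density w) <= _).
      rewrite ler_pM2l; first exact (far _ Jw).
      by lra.
    have : ka * density w <= 2^-1.
      rewrite -kaB ler_pM2l //.
      exact (JB _ Jw).
    by move=> h; have := ler_wpM2r D0 h; lra.
  by lra.
have bz' : bounded_orbit p z'.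
  apply: contrapT => nb.
  have bpz : bounded_orbit p p.[z] by apply/bounded_orbit_step.
  have [v Jv le_v] := julia_between escS bpz nb.
  have := image_far v Jv; have := JB v Jv.
  rewrite normc_subC => h1 h2.
  have : normc (v - p.[z]) * density v <= normc (z' - p.[z]) * B.
    by apply: ler_pM; rewrite ?normc_ge0 //; have := density_ge1 v; lra.
  have : ka * e <= e by rewrite ler_piMl // ltW.
  by have := mulr_gt0 ka0 e0; lra.
split; first exact: bz'.
move=> w Jw; have := image_far w Jw; have := JB w Jw.
have := normc_dist_le p.[z] z' w; rewrite (normc_subC p.[z] z') => h1 h2 h3.
have w1 := density_ge1 w.
have w0 : 0 <= density w by lra.
have h4 := ler_wpM2r w0 h1.
have : normc (z' - p.[z]) * density w <= normc (z' - p.[z]) * B.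
  by rewrite ler_wpM2l ?normc_ge0.
by have := mulr_gt0 ka0 e0; lra.
Qed.

(** Otherwise slower and slower points accumulate at a point whose orbit is
unbounded, as the Julia set is far away; but by continuity its neighbours
escape as fast as it does. *)
Lemma uniform_escape (de r T : R) : 0 < de -> exists H, forall z : C,
  normc z <= r -> ~ bounded_orbit p z ->
  (forall w : C, julia p w -> de <= normc (z - w)) ->
  exists2 h, (h < H)%N & T <= normc (orbit p h.+1 z).
Proof.
move=> de0; apply: contrapT => no.
have bad H : exists z : C, [/\ normc z <= r, ~ bounded_orbit p z,
    forall w : C, julia p w -> de <= normc (z - w) &
    forall h, (h < H)%N -> normc (orbit p h.+1 z) < T].
  apply: contrapT => none; apply: no; exists H => z le_z nb far.
  apply: contrapT => slow; apply: none; exists z; split=> [|||h lt_h].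
  - exact: le_z.
  - exact: nb.
  - exact: far.
  - by rewrite ltNge; apply/negP => le_T; apply: slow; exists h.
have [u Hu] := choice bad.
have le_u n' : normc (u n') <= r by have [] := Hu n'.
have [z clu] := bounded_cluster le_u.
have nbz : ~ bounded_orbit p z.
  move=> bz; have de2 : 0 < de / 2 by rewrite divr_gt0.
  have [k _ near] := clu _ de2 0%N.
  have [_ nb far _] := Hu k.
  have [v Jv le_v] := julia_between escS bz nb.
  have := far v Jv; have := normc_dist_le (u k) z v.
  by rewrite (normc_subC z v); lra.
have [h le_h] : exists h, T + 1 <= normc (orbit p h.+1 z).
  have [m le_m] : exists m, S <= normc (orbit p m z).
    apply: contrapT => none; apply: nbz; apply/(bounded_orbitP escS) => m.
    by rewrite ltNge; apply/negP => le_m; apply: none; exists m.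
  have [j le_j] := unbounded_powers (T + 1) (ltr1n R 2).
  exists (j + m)%N; rewrite -addSn orbitD.
  apply: le_trans (escape_growth escS j.+1 le_m).
  by apply: le_trans le_j _; rewrite exprS ler_peMl ?exprn_ge0 //; lra.
have [e e0 He] := orbit_continuous p h.+1 z (ltr01 : 0 < 1 :> R).
have [k le_k near] := clu e e0 h.+1.
have [_ _ _ /(_ h le_k)] := Hu k; have := He _ near.
by have := normc_sub_ge (orbit p h.+1 z) (orbit p h.+1 (u k)); rewrite normc_subC; lra.
Qed.

End ExpandingMetric.

(** * Hyperbolic polynomials have certificates *)

Section Completeness.
Variables (R : realType) (p : {poly R[i]}) (S0 : R) (S : nat).
Local Notation C := R[i].
Hypotheses (esc : escape_radius p S0) (mon_p : p \is monic).
Hypotheses (size_p : (1 < size p)%N) (hyp : hyperbolic p).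
Hypothesis S0_lt : S0 + 1 <= S%:R.

Lemma orbit_lipschitz (H : nat) (r : R) : exists2 L : R, 0 < L &
  forall h z w, (h <= H)%N -> normc z <= r -> normc w <= r ->
    normc (orbit p h z - orbit p h w) <= L * normc (z - w).
Proof.
elim: H => [|H [L L0 HL]].
  by exists 1 => // -[|//] z w _ _ _; rewrite mul1r.
have [L' L'0 HL'] := poly_lipschitz (iterate p H.+1) r.
exists (L + L') => [|h z w]; first by rewrite addr_gt0.
rewrite leq_eqVlt => /predU1P[->|lt_h] le_z le_w; rewrite mulrDl.
  rewrite -!horner_iterate; apply: le_trans (HL' _ _ le_z le_w) _.
  by rewrite lerDr mulr_ge0 ?normc_ge0 // ltW.
apply: le_trans (HL h _ _ _ le_z le_w) _; first by rewrite -ltnS.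
by rewrite lerDl mulr_ge0 ?normc_ge0 // ltW.
Qed.

(** With densities rounded up from 6 rho, a gain of 1/2 becomes 3, which pays 1
for the rounding, 1 for the required gain and 1 for the margins. *)
Lemma weight_inequality (k B x y P Q W1 W2 : R) :
  0 <= k -> (6 * B + 1) * (2 * k) <= 1 -> 0 <= P -> 1 <= y -> y <= B ->
  x + 2^-1 <= P * y -> W1 <= 6 * x + 1 -> 6 * y <= W2 -> W2 <= 6 * y + 1 ->
  P - k <= Q -> W1 + 1 + W2 * k <= Q * W2.
Proof.
move=> k0 kB P0 y1 y_B gain w1 w2 w2' q_ge.
have i1 : (P - k) * W2 <= Q * W2 by rewrite ler_wpM2r //; lra.
have i2 : P * (6 * y) <= P * W2 by rewrite ler_wpM2l.
have i3 : 2 * k * W2 <= 2 * k * (6 * B + 1).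
  by rewrite ler_wpM2l ?mulr_ge0 //; lra.
by lra.
Qed.

(** Trapped points get rank 1. An unbounded orbit gets the first time at which
its modulus exceeds a threshold that grows slightly with that time: since the
threshold of the image is lower by [tau], the rank also drops along
pseudo-orbits. All other grid points are close to the Julia set. Their weights
are the integer parts of 6 rho. *)
Theorem hyperbolic_certificate (K : R) : 0 <= K ->
  exists N0, forall N, (0 < N)%N -> (N0 <= N)%N ->
  exists rank weight, forall q : {poly C},
    (forall u v, (u <= 2 * S * N)%N -> (v <= 2 * S * N)%N ->
       normc (q.[grid_point R N S u v] - p.[grid_point R N S u v]) <= K / N%:R /\
       normc (q^`().[grid_point R N S u v] - p^`().[grid_point R N S u v])
         <= K / N%:R) ->
    certificate N S q (K / N%:R) rank weight.
Proof.
move=> K0; have [n n_gt0 exp_n] := expanding_power hyp.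
have [de de0 [s1 s10 exp_near]] := density_expanding_near esc n_gt0 exp_n.
have [e /andP[e0 e_de] [s2 s20 trap]] :=
  trap_invariant esc n_gt0 exp_n mon_p size_p de0.
pose R0 : R := 2 * S%:R + 1.
have [H escH] := uniform_escape esc (2 * S%:R) (R0 + 1) de0.
have [Bp Bp0 HBp] := poly_bounded p (2 * S%:R).
have [L L0 HL] := orbit_lipschitz H (Bp + 1).
have [B B1 HB] := density_bounded p n (2 * S%:R).
(* The thresholds [R0 + h.+1%:R * tau], for h < H, stay below [R0 + 1]. *)
pose tau : R := (H.+1%:R)^-1.
have tau0 : 0 < tau by rewrite invr_gt0.
pose m0 := Num.min (Num.min s1 s2) (Num.min 1 (Num.min (tau / L) (6 * B + 1)^-1)).
have B60 : 0 < 6 * B + 1 by lra.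
have m00 : 0 < m0 by rewrite /m0 !lt_min s10 s20 ltr01 divr_gt0 //= invr_gt0.
exists (Num.bound (2 * K / m0)) => N N_gt0 le_N.
have N0 : 0 < N%:R :> R by rewrite ltr0n.
set k := K / N%:R; have k0 : 0 <= k by rewrite divr_ge0 // ltW.
have k_m0 : 2 * k <= m0.
  rewrite /k mulrA ler_pdivrMr // [m0 * _]mulrC -ler_pdivrMr //.
  have Kn : 0 <= 2 * K / m0 by rewrite divr_ge0 ?mulr_ge0 // ltW.
  by apply: le_trans (ltW (archi_boundP Kn)) _; rewrite ler_nat.
clearbody k.
have [[ks1 ks2] k1 kL kB] : [/\ 2 * k <= s1 /\ 2 * k <= s2, 2 * k <= 1,
    L * (2 * k) <= tau & (6 * B + 1) * (2 * k) <= 1].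
  move: k_m0; rewrite /m0 !le_min => /andP[/andP[h1 h2] /and3P[h3 h4 h5]].
  split=> //; first by rewrite mulrC -ler_pdivlMr.
  by rewrite mulrC -ler_pdivlMr // mul1r.
pose pt := grid_point R N S.
pose slow z h := R0 + h.+1%:R * tau <= normc (orbit p h.+1 z).
pose level z := find (slow z) (iota 0 H).
pose rank u v := if `[< trapped p n e (pt u v) >] then 1%N else
  if (level (pt u v) < H)%N then (level (pt u v)).+2 else 0%N.
pose weight u v := Num.trunc (6 * density p n (pt u v)).
exists rank, weight => q close.
have levelP z h : (h < H)%N -> slow z h -> (level z <= h)%N.
  move=> lt_h sl; rewrite leqNgt; apply/negP => /(before_find 0%N).
  by rewrite nth_iota // add0n sl.
have level_slow z : (level z < H)%N -> slow z (level z).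
  move=> lt_l; have : has (slow z) (iota 0 H) by rewrite has_find size_iota.
  by move/(nth_find 0%N); rewrite -/(level z) nth_iota.
split=> [u v le_u le_v|u v u' v' le_u le_v le_u' le_v' near].
  rewrite /rank; case: asboolP => [[bz _] _|_]; last by case: ifP.
  have lt_p := bounded_orbit_lt esc ((bounded_orbit_step p (pt u v)).2 bz).
  have [h _] := close u v le_u le_v.
  have le_q := le_trans (normc_le_add q.[pt u v] _) (lerD (ltW lt_p) h).
  apply: le_trans (lerD le_q (lexx k)) _; have := S0_lt.
  by clear -k1 S0_lt esc mon_p size_p hyp; lra.
have [close1 close2] := close u v le_u le_v.
have bz := grid_point_bound R N_gt0 le_u le_v.
have bz' := grid_point_bound R N_gt0 le_u' le_v'.
rewrite -/(pt u v) -/(pt u' v') in near close1 close2 bz bz'.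
have near_p : normc (pt u' v' - p.[pt u v]) <= 2 * k.
  have near' : normc (pt u' v' - q.[pt u v]) <= k by rewrite normc_subC.
  have := le_trans (normc_dist_le _ q.[pt u v] _) (lerD near' close1).
  by rewrite (_ : k + k = 2 * k) //; ring.
split.
- rewrite [rank u v]/rank; case: asboolP => [//|_]; case: ifP => // lt_l _.
  have := level_slow _ lt_l; set l := level (pt u v); rewrite /slow orbitSr => sl.
  have le_pz := HBp _ bz.
  have le_z' : normc (pt u' v') <= Bp + 1.
    apply: le_trans (normc_le_add _ _) (lerD le_pz (le_trans near_p k1)).
  have : R0 + l%:R * tau <= normc (orbit p l (pt u' v')).
    have lip : normc (orbit p l p.[pt u v] - orbit p l (pt u' v')) <= tau.
      apply: le_trans (HL _ _ _ (ltnW lt_l) _ le_z') _.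
        by apply: le_trans le_pz _; rewrite lerDl.
      by rewrite normc_subC; apply: le_trans kL; rewrite ler_pM2l.
    have := normc_sub_ge (orbit p l p.[pt u v]) (orbit p l (pt u' v')).
    by move: sl lip; rewrite -natr1; clear -S0_lt esc mon_p size_p hyp; lra.
  case El: l => [|l'] sl'.
    by have := le_trans sl' bz'; rewrite mul0r /R0; clear -S0_lt esc mon_p size_p hyp; lra.
  have lt_l' : (l' < H)%N by apply: leq_trans lt_l; rewrite -/l El.
  have le_l := levelP _ _ lt_l' sl'.
  rewrite /rank; case: asboolP => [[/(bounded_orbitP esc) /(_ l'.+1) lt_S0 _]|_].
    have : 0 <= l'.+1%:R * tau by rewrite mulr_ge0 // ltW.
    have := le_lt_trans sl' lt_S0; have := S0_lt.
    by have : 0 <= S%:R :> R by []; rewrite /R0; clear -S0_lt esc mon_p size_p hyp; lra.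
  by rewrite (leq_ltn_trans le_l lt_l') /= !ltnS.
- rewrite /rank; case: asboolP => [tr _|_]; last by case: ifP.
  case: asboolP => // nt; case: nt.
  exact (trap _ _ tr (le_trans near_p ks2)).
rewrite {1}/rank; case: asboolP => // nt; case: ifP => // /negP lt_l _ _.
have [w Jw near_w] : exists2 w : C, julia p w & normc (pt u v - w) <= de.
  apply: contrapT => far.
  have far' w : julia p w -> de < normc (pt u v - w).
    move=> Jw; rewrite ltNge; apply/negP => le_de; apply: far.
    exists w; [exact Jw | exact le_de].
  have [bo|nbo] := EM (bounded_orbit p (pt u v)).
    apply: nt; split; first exact bo.
    move=> w Jw; have := far' w Jw; have := density_ge1 p n_gt0 w.
    move=> ge1 lt_de; apply: le_trans e_de _; apply: le_trans (ltW lt_de) _.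
    by rewrite ler_peMr ?normc_ge0.
  have [h lt_h le_h] := escH _ bz nbo (fun w Jw => ltW (far' w Jw)).
  apply: lt_l; apply: leq_ltn_trans (lt_h); apply: levelP => //.
  rewrite /slow; apply: le_trans le_h; rewrite lerD2l /tau ler_pdivrMr // mul1r ler_nat.
  by rewrite ltnS ltnW.
have exp := exp_near _ _ _ Jw near_w (le_trans near_p ks1).
have d1 := density_ge1 p n_gt0 (pt u v); have d2 := density_ge1 p n_gt0 (pt u' v').
have b2 := HB _ bz'.
have trW z : 1 <= density p n z ->
    6 * density p n z <= (Num.trunc (6 * density p n z)).+1%:R <=
    6 * density p n z + 1.
  move=> ge1; have /truncn_itv/andP[le_t lt_t] : 0 <= 6 * density p n z.
    by rewrite mulr_ge0 // (le_trans ler01).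
  by rewrite ltW //= -natr1 lerD2r.
rewrite -[X in X + _]natr1.
set W1 := (weight u v).+1%:R; set W2 := (weight u' v').+1%:R.
have /andP[_ w1] : 6 * density p n (pt u v) <= W1 <=
    6 * density p n (pt u v) + 1 by exact: trW.
have /andP[w2 w2'] : 6 * density p n (pt u' v') <= W2 <=
    6 * density p n (pt u' v') + 1 by exact: trW.
apply: (weight_inequality (x := density p n (pt u v))
  (y := density p n (pt u' v')) (P := normc p^`().[pt u v]) (B := B)) => //.
- exact: normc_ge0.
- rewrite lerBlDr; apply: le_trans (normc_le_add _ q^`().[pt u v]) _.
  by rewrite lerD2l normc_subC.
Qed.

End Completeness.

(** * Dependence of a centered polynomial on its coefficients *)

Section CenteredPolynomials.
Variables (R : realType) (d : nat).
Local Notation C := R[i].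
Local Notation m := d.-1.
Implicit Types (a b : 'rV[C]_m).

Lemma horner_centered a z :
  (centered_poly a).[z] = z ^+ d + \sum_(j < m) a 0 j * z ^+ j.
Proof.
rewrite /centered_poly hornerD hornerXn horner_sum; congr (_ + _).
by apply: eq_bigr => j _; rewrite hornerZ hornerXn.
Qed.

Lemma horner_deriv_centered a z : (centered_poly a)^`().[z] =
  z ^+ d.-1 *+ d + \sum_(j < m) a 0 j * (z ^+ j.-1 *+ j).
Proof.
rewrite /centered_poly derivD derivXn raddf_sum hornerD hornerMn hornerXn.
rewrite horner_sum; congr (_ + _); apply: eq_bigr => j _.
by rewrite /= derivZ hornerZ derivXn hornerMn hornerXn.
Qed.

Hypothesis d_ge2 : (2 <= d)%N.

Lemma size_centered a : size (centered_poly a) = d.+1.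
Proof.
rewrite /centered_poly size_polyDl size_polyXn // ltnS.
apply: leq_trans (size_sum _ _ _) _; apply/bigmax_leqP => j _.
apply: leq_trans (size_scale_leq _ _) _; rewrite size_polyXn.
by have := ltn_ord j; lia.
Qed.

Lemma monic_centered a : centered_poly a \is monic.
Proof.
apply/monicP; rewrite lead_coefE size_centered /= /centered_poly coefD coefXn.
rewrite eqxx coef_sum big1 ?addr0 // => j _.
rewrite coefZ coefXn gtn_eqF ?mulr0 //.
by have := ltn_ord j; lia.
Qed.

Lemma escape_radius_centered a (S : R) :
  2 + \sum_(j < m) normc (a 0 j) <= S -> escape_radius (centered_poly a) S.
Proof.
set A := \sum_(j < m) _ => le_S.
have A0 : 0 <= A by apply: sumr_ge0 => j _; apply: normc_ge0.
split=> [|z le_z]; first by lra.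
have z2 : 2 <= normc z by lra.
have z1 : 1 <= normc z by lra.
rewrite horner_centered.
have low : normc (\sum_(j < m) a 0 j * z ^+ j) <= A * normc z ^+ d.-1.
  apply: le_trans (normc_sum _ _ _) _; rewrite /A mulr_suml.
  apply: ler_sum => j _; rewrite normcM normcX ler_wpM2l ?normc_ge0 //.
  by rewrite ler_weXn2l //; have := ltn_ord j; lia.
have := normc_sub_ge (z ^+ d) (- \sum_(j < m) a 0 j * z ^+ j).
rewrite opprK normc_opp normcX; apply: le_trans.
apply: le_trans (lerB (lexx _) low).
have -> : normc z ^+ d = normc z * normc z ^+ d.-1.
  by rewrite -exprS prednK //; lia.
rewrite -mulrBl.
apply: le_trans (_ : 2 * normc z ^+ d.-1 <= _).
  rewrite ler_pM2l // -[leLHS]expr1 ler_weXn2l //; lia.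
by rewrite ler_wpM2r ?exprn_ge0 //; lra.
Qed.

Lemma power_lipschitz k (r : R) (z w : C) : 1 <= r -> normc z <= r ->
  normc w <= r -> normc (z ^+ k - w ^+ k) <= k%:R * r ^+ k * normc (z - w).
Proof.
move=> r1 le_z le_w; have r0 : 0 <= r by lra.
elim: k => [|k IH]; first by rewrite subrr (normc0 R) !mul0r.
have -> : z ^+ k.+1 - w ^+ k.+1 = z ^+ k * (z - w) + (z ^+ k - w ^+ k) * w.
  by rewrite !exprSr; ring.
apply: le_trans (normcD _ _) _; rewrite !normcM normcX.
have h1 : normc z ^+ k <= r ^+ k by rewrite lerXn2r ?nnegrE ?normc_ge0.
have h2 : r ^+ k <= r ^+ k.+1 by rewrite exprSr ler_peMr ?exprn_ge0.
have D0 := normc_ge0 (z - w).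
have h3 : normc z ^+ k * normc (z - w) <= r ^+ k.+1 * normc (z - w).
  by rewrite ler_wpM2r // (le_trans h1).
have h4 : normc (z ^+ k - w ^+ k) * normc w <=
    k%:R * r ^+ k * normc (z - w) * r by apply: ler_pM; rewrite ?normc_ge0.
have -> : k.+1%:R * r ^+ k.+1 * normc (z - w) = r ^+ k.+1 * normc (z - w) +
   k%:R * r ^+ k * normc (z - w) * r by rewrite -natr1 exprSr; ring.
exact: lerD.
Qed.

Section Perturbation.
Variables (a b : 'rV[C]_m) (r de eta : R) (z w : C).
Hypotheses (r1 : 1 <= r) (le_z : normc z <= r) (le_w : normc w <= r).
Hypothesis near_zw : normc (z - w) <= de.
Hypothesis le_a : forall j, normc (a 0 j) <= r.
Hypothesis near_ab : forall j, normc (a 0 j - b 0 j) <= eta.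

Let unit_gap : R := d%:R * r ^+ d.+1 * (de + eta).

Let de0 : 0 <= de. Proof. exact: le_trans (normc_ge0 _) near_zw. Qed.

Lemma power_close k : (k <= d)%N ->
  normc (z ^+ k - w ^+ k) <= d%:R * r ^+ d * de.
Proof.
move=> le_k; have r0 : 0 <= r by have := r1; lra.
apply: le_trans (power_lipschitz k r1 le_z le_w) _.
apply: ler_pM => //; rewrite ?mulr_ge0 ?exprn_ge0 ?normc_ge0 //.
by apply: ler_pM; rewrite ?exprn_ge0 ?ler_nat // ler_weXn2l.
Qed.

Lemma eta_ge0 : (0 < m)%N -> 0 <= eta.
Proof. by move=> m0; apply: le_trans (normc_ge0 _) (near_ab (Ordinal m0)). Qed.

Lemma lead_close k : (k <= d)%N -> normc (z ^+ k - w ^+ k) <= unit_gap.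
Proof.
move=> le_k; have r0 : 0 <= r by have := r1; lra.
have e0 : 0 <= eta by apply: eta_ge0; lia.
apply: le_trans (power_close le_k) _; rewrite /unit_gap.
apply: ler_pM; rewrite ?mulr_ge0 ?exprn_ge0 //; last by rewrite lerDl.
by rewrite ler_wpM2l // exprSr ler_peMr ?exprn_ge0.
Qed.

Lemma term_close (j : 'I_m) k : (k <= d)%N ->
  normc (a 0 j * z ^+ k - b 0 j * w ^+ k) <= unit_gap.
Proof.
move=> le_k; have r0 : 0 <= r by have := r1; lra.
have e0 : 0 <= eta by apply: eta_ge0; lia.
have -> : a 0 j * z ^+ k - b 0 j * w ^+ k =
  a 0 j * (z ^+ k - w ^+ k) + (a 0 j - b 0 j) * w ^+ k by ring.
apply: le_trans (normcD _ _) _; rewrite !normcM normcX.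
have h1 : normc (a 0 j) * normc (z ^+ k - w ^+ k) <= r * (d%:R * r ^+ d * de).
  by apply: ler_pM; rewrite ?normc_ge0 ?power_close.
have h2 : normc (a 0 j - b 0 j) * normc w ^+ k <= eta * r ^+ d.
  apply: ler_pM; rewrite ?normc_ge0 ?exprn_ge0 ?normc_ge0 //.
  by apply: le_trans (_ : r ^+ k <= _); rewrite ?lerXn2r ?nnegrE ?normc_ge0 // ler_weXn2l.
apply: le_trans (lerD h1 h2) _.
have -> : unit_gap = r * (d%:R * r ^+ d * de) + d%:R * (eta * r ^+ d.+1).
  by rewrite /unit_gap exprS; ring.
rewrite lerD2l; apply: le_trans (_ : eta * r ^+ d.+1 <= _).
  by rewrite ler_wpM2l // exprSr ler_peMr ?exprn_ge0.
by rewrite ler_peMl ?mulr_ge0 ?exprn_ge0 // ler1n ltnW.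
Qed.

Let unit_gap0 : 0 <= unit_gap.
Proof. exact: le_trans (normc_ge0 _) (lead_close (leqnn d)). Qed.

Lemma total_gap (c : nat) : (c <= d)%N -> unit_gap *+ c + unit_gap *+ c *+ m <=
  d%:R ^+ 3 * r ^+ d.+1 * (de + eta).
Proof.
move=> le_c; rewrite -mulrS prednK; last by lia.
have -> : d%:R ^+ 3 * r ^+ d.+1 * (de + eta) = unit_gap *+ d *+ d.
  by rewrite /unit_gap -mulrnA -[RHS]mulr_natr natrM; ring.
by rewrite lerMn2r ler_wpMn2l ?orbT.
Qed.

(** Each of the at most d terms changes by at most [unit_gap]; the third factor d
in the bound is there for the derivative, which multiplies terms by exponents
up to d. *)
Lemma centered_close : normc ((centered_poly a).[z] - (centered_poly b).[w]) <=
  d%:R ^+ 3 * r ^+ d.+1 * (de + eta).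
Proof.
have d1 : (1 <= d)%N by lia.
apply: le_trans (total_gap d1).
rewrite !horner_centered opprD addrACA -sumrB mulr1n.
apply: le_trans (normcD _ _) _; apply: lerD; first exact: lead_close.
apply: le_trans (normc_sum _ _ _) _.
rewrite -[m in leRHS]card_ord -sumr_const; apply: ler_sum => j _.
by apply: term_close; have := ltn_ord j; lia.
Qed.

Lemma centered_deriv_close :
  normc ((centered_poly a)^`().[z] - (centered_poly b)^`().[w]) <=
  d%:R ^+ 3 * r ^+ d.+1 * (de + eta).
Proof.
apply: le_trans (total_gap (leqnn d)).
rewrite !horner_deriv_centered opprD addrACA -sumrB.
apply: le_trans (normcD _ _) _; apply: lerD.
  by rewrite -mulrnBl normcMn lerMn2r lead_close ?orbT //; lia.
apply: le_trans (normc_sum _ _ _) _.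
rewrite -[m in leRHS]card_ord -sumr_const; apply: ler_sum => j _.
have lt_j := ltn_ord j.
rewrite !mulrnAr -mulrnBl normcMn.
apply: le_trans (_ : unit_gap *+ j <= _); last by rewrite ler_wpMn2l //; lia.
by rewrite lerMn2r term_close ?orbT //; lia.
Qed.

End Perturbation.
End CenteredPolynomials.

(** * Balls of coefficients with a certificate *)

Section Balls.
Variables (R : realType) (d : nat).
Local Notation C := R[i].
Local Notation m := d.-1.
Hypothesis d_ge2 : (2 <= d)%N.

(** Over this denominator, the points with odd numerators come closer than 2^-i
to every point: there are m + m coordinates, with an error of 1/N each. *)
Definition mesh (i : nat) : nat := 2 ^ (i + (m + m)).

(** The margin in units of 1/N. A point is within 3/N of a grid point, the
coefficients vary by 2^-i = 2^(m + m) / N, and 2/N is the distance from the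
image to the nearest grid point. The factor 4S bounds the moduli involved. *)
Definition slack (S : nat) : nat :=
  d ^ 3 * (4 * S) ^ d.+1 * (3 + 2 ^ (m + m)) + 2.

(** An odd numerator over a power of two is in lowest terms. *)
Definition odd_rat (N sg y : nat) : rat :=
  (-1) ^+ (0 < sg)%N * (y.*2.+1)%:R / N%:R.

Definition odd_point (N : nat) (sg y : nat -> nat) : 'rV[rat]_(m + m) :=
  \row_j odd_rat N (sg j) (y j).

Definition complexify (x : 'rV[R]_(m + m)) : 'rV[C]_m :=
  \row_j (x 0 (lshift m j) +i* x 0 (rshift m j))%C.

Lemma complexifyK x : realify (complexify x) = x.
Proof.
apply/rowP => k; rewrite -(splitK k); case: (split k) => j /=.
  by rewrite row_mxEl !mxE.
by rewrite row_mxEr !mxE.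
Qed.

Lemma realifyK (a : 'rV[C]_m) : complexify (realify a) = a.
Proof.
by apply/rowP => j; rewrite mxE row_mxEl row_mxEr !mxE; case: (a 0 j).
Qed.

(** In the ball each of the m coefficients varies by at most 1, so the first
condition makes [S] an escape radius of all its polynomials. *)
Definition valid_ball (i S : nat) (rank weight : nat -> nat -> nat)
    (x : 'rV[rat]_(m + m)) : Prop :=
  2 + m%:R + \sum_j `|x 0 j| <= S%:R /\
  certificate (mesh i) S (centered_poly (complexify (ideal_point R x)))
    ((slack S)%:R / (mesh i)%:R) rank weight.

Lemma mesh_gt0 i : (0 < mesh i)%N.
Proof. by rewrite expn_gt0. Qed.

Lemma radius_mesh i : 2 ^ (- i%:Z) = (2 ^ (m + m))%:R / (mesh i)%:R :> R.
Proof.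
rewrite -exprnN /mesh !natrX [2 ^+ (i + _)]exprD.
have : 2 ^+ i != 0 :> R by rewrite expf_neq0 ?pnatr_eq0.
have : 2 ^+ (m + m) != 0 :> R by rewrite expf_neq0 ?pnatr_eq0.
move: (2 ^+ i) (2 ^+ (m + m)) => u v v0 u0.
by field; rewrite u0 v0.
Qed.

Lemma euclidean_dist_coord (x y : 'rV[R]_(m + m)) (j : 'I_m) :
  normc (complexify x 0 j - complexify y 0 j) <= euclidean_dist x y.
Proof.
rewrite !mxE /euclidean_dist -[_ - _]/(Complex (_ - _) (_ - _)) /=.
rewrite ler_sqrt; last by apply: sumr_ge0 => k _; apply: sqr_ge0.
rewrite big_split_ord /= (bigD1 j) //= [X in _ <= _ + X](bigD1 j) //=.
have s1 : 0 <= \sum_(k < m | k != j) (x 0 (lshift m k) - y 0 (lshift m k)) ^+ 2.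
  by apply: sumr_ge0 => k _; apply: sqr_ge0.
have s2 : 0 <= \sum_(k < m | k != j) (x 0 (rshift m k) - y 0 (rshift m k)) ^+ 2.
  by apply: sumr_ge0 => k _; apply: sqr_ge0.
by lra.
Qed.

Lemma sum_complexify (x : 'rV[R]_(m + m)) :
  \sum_j normc (complexify x 0 j) <= \sum_j `|x 0 j|.
Proof.
rewrite big_split_ord /= -big_split /=; apply: ler_sum => j _.
by rewrite !mxE; apply: normc_ReIm.
Qed.

Lemma slackE (S : nat) (N : R) : N != 0 ->
  d%:R ^+ 3 * (4 * S%:R) ^+ d.+1 * (3 / N + (2 ^ (m + m))%:R / N) + 2 / N =
  (slack S)%:R / N.
Proof.
move=> N0; rewrite /slack natrD natrM natrM natrD !natrX natrM.

move: ((4 * _) ^+ _) (2 ^+ (m + m)) (d%:R ^+ 3) => u v w.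

by field.
Qed.

Lemma ratr_bound (q : rat) : ratr (2 + m%:R + q) = 2 + m%:R + ratr q :> R.
Proof. by rewrite rmorphD /= -natrD ratr_nat natrD. Qed.

Lemma sum_ideal_point (x : 'rV[rat]_(m + m)) :
  \sum_j `|ideal_point R x 0 j| = ratr (\sum_j `|x 0 j|).
Proof.
by rewrite rmorph_sum; apply: eq_bigr => j _; rewrite mxE /= ratr_norm.
Qed.

Theorem valid_ball_hyperbolic i S rank weight x :
  valid_ball i S rank weight x ->
  (ideal_ball x i%:Z `<=` (@realify R m) @` hyperbolic_locus R d)%classic.
Proof.
move=> [bound cert] y near_y; exists (complexify y); last exact: complexifyK.
set N := mesh i in cert; have N_gt0 : (0 < N)%N := mesh_gt0 i.
have N0 : 0 < N%:R :> R by rewrite ltr0n.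
have N1 : 1 <= N%:R :> R by rewrite ler1n.
pose c := complexify (ideal_point R x); pose a := complexify y.
pose eta : R := (2 ^ (m + m))%:R / N%:R.
have near j : normc (a 0 j - c 0 j) <= eta.
  rewrite /eta -radius_mesh normc_subC.
  by apply: le_trans (euclidean_dist_coord _ _ _) (ltW near_y).
have eta1 : eta <= 1.
  rewrite /eta ler_pdivrMr // mul1r ler_nat /N /mesh.
  by rewrite leq_exp2l // leq_addl.
have boundR : 2 + m%:R + \sum_j `|ideal_point R x 0 j| <= S%:R.
  by rewrite sum_ideal_point; move: bound; rewrite -(ler_rat R) ratr_bound ratr_nat.
have a_bound : 2 + \sum_j normc (a 0 j) <= S%:R.
  have : \sum_j normc (a 0 j) <= \sum_(j < m) (normc (c 0 j) + 1).
    apply: ler_sum => j _; apply: le_trans (normc_le_add _ (c 0 j)) _.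
    by rewrite lerD2l; apply: le_trans (near j) eta1.
  rewrite big_split /= sumr_const card_ord.
  by have := sum_complexify (ideal_point R x); rewrite -/c; lra.
have S_ge2 : 2 <= S%:R :> R.
  by apply: le_trans a_bound; rewrite lerDl sumr_ge0 // => j _; apply: normc_ge0.
have le_a j : normc (a 0 j) <= 4 * S%:R.
  have : normc (a 0 j) <= \sum_j normc (a 0 j).
    rewrite (bigD1 j) //= lerDl sumr_ge0 // => k _; exact: normc_ge0.
  by lra.
change (hyperbolic (centered_poly a)).
apply: (certificate_hyperbolic N_gt0 _ cert).
  exact: escape_radius_centered.
move=> u v z le_u le_v near_z.
have le_pt := grid_point_bound R N_gt0 le_u le_v.
have le_z : normc z <= 4 * S%:R.
  have : 3 / N%:R <= 3 :> R by rewrite ler_pdivrMr //; lra.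
  have := le_trans (normc_le_add z _) (lerD le_pt near_z).
  by lra.
have le_pt4 : normc (grid_point R N S u v) <= 4 * S%:R by lra.
have r1 : 1 <= 4 * S%:R :> R by lra.
have E := slackE S (lt0r_neq0 N0); rewrite -/eta in E.
split; rewrite -E.
  rewrite lerD2r.
  exact: (centered_close d_ge2 r1 le_z le_pt4 near_z le_a near).
apply: le_trans (centered_deriv_close d_ge2 r1 le_z le_pt4 near_z le_a near) _.
by rewrite lerDl divr_ge0.
Qed.

Lemma odd_rat_near (N : nat) (t : R) : (0 < N)%N ->
  exists sg y, `|t - ratr (odd_rat N sg y)| <= N%:R^-1.
Proof.
move=> N_gt0; have N0 : 0 < N%:R :> R by rewrite ltr0n.
have near (s : R) : 0 <= s -> exists y : nat, `|s - (y.*2.+1)%:R / N%:R| <= N%:R^-1.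
  move=> s0; have /truncn_itv/andP[] : 0 <= s * N%:R / 2.
    by rewrite divr_ge0 ?mulr_ge0.
  set y := Num.trunc _ => le_y lt_y; exists y.
  have -> : s - (y.*2.+1)%:R / N%:R = (s * N%:R - (y.*2.+1)%:R) / N%:R.
    by field; rewrite gt_eqF.
  rewrite normrM [`|N%:R^-1|]gtr0_norm ?invr_gt0 // ler_piMl ?invr_ge0 //.
  rewrite -[_.*2.+1%:R]natr1 -muln2 natrM; move: lt_y; rewrite -[y.+1%:R]natr1 => lt_y.
  by rewrite ler_norml; apply/andP; split; lra.
have [t0|t0] := lerP 0 t.
  have [y Hy] := near t t0; exists 0%N, y.
  by rewrite /odd_rat /= mul1r fmorph_div /= !ratr_nat.
have [y Hy] := near (- t) (ltac:(by rewrite oppr_ge0 ltW)); exists 1%N, y.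
rewrite /odd_rat /= mulN1r mulNr rmorphN fmorph_div /= !ratr_nat opprK.
by rewrite -normrN opprD.
Qed.

(** The square is chosen before the mesh, since the margin depends on it. *)
Theorem hyperbolic_valid_ball (a : 'rV[C]_m) : hyperbolic (centered_poly a) ->
  exists i S sg y rank weight,
    valid_ball i S rank weight (odd_point (mesh i) sg y) /\
    ideal_ball (odd_point (mesh i) sg y) i%:Z (realify a).
Proof.
move=> hyp; pose x0 := realify a.
pose S0 : R := 2 + \sum_j normc (a 0 j).
have esc : escape_radius (centered_poly a) S0 by apply: escape_radius_centered.
have sumx0 : 0 <= \sum_j `|x0 0 j| by apply: sumr_ge0.
(* The last summand allows each coordinate of the centre to differ by 1. *)
pose A : R := 3 + m%:R + \sum_j `|x0 0 j| + (m + m)%:R.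
have A0 : 0 <= A by rewrite /A !addr_ge0.
pose S := (Num.bound A).+1.
have lt_S : A < S%:R.
  by apply: lt_trans (archi_boundP A0) _; rewrite ltr_nat.
have sum_a : \sum_j normc (a 0 j) <= \sum_j `|x0 0 j|.
  by rewrite -{1}(realifyK a) sum_complexify.
have mm0 : 0 <= (m + m)%:R :> R by [].
have m0 : 0 <= m%:R :> R by [].
have S0S : S0 + 1 <= S%:R by rewrite /S0; move: lt_S; rewrite /A; lra.
have S1 : 1 <= S%:R :> R by rewrite ler1n.
have sz : (1 < size (centered_poly a))%N by rewrite size_centered // ltnS ltnW.
have [N0 HN0] := hyperbolic_certificate esc (monic_centered d_ge2 a) sz hyp S0S
  (ler0n R (slack S)).
pose i := N0; pose N := mesh i.
have N_gt0 : (0 < N)%N := mesh_gt0 i.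
have NR0 : 0 < N%:R :> R by rewrite ltr0n.
have le_N : (N0 <= N)%N.
  rewrite /N /mesh /i; apply: leq_trans (ltnW (ltn_expl N0 (ltnSn 1))) _.
  by rewrite leq_exp2l // leq_addr.
have [rank [weight cert]] := HN0 N N_gt0 le_N.
have approx (j : nat) : exists sy : nat * nat, forall k : 'I_(m + m), k = j :> nat ->
    `|x0 0 k - ratr (odd_rat N sy.1 sy.2)| <= N%:R^-1.
  have [lt_j|ge_j] := ltnP j (m + m).
    have [sg [y near]] := odd_rat_near (x0 0 (Ordinal lt_j)) N_gt0.
    by exists (sg, y) => k Ek; rewrite (_ : k = Ordinal lt_j) //; apply/val_inj.
  by exists (0%N, 0%N) => k Ek; have := ltn_ord k; rewrite Ek ltnNge ge_j.
have [sy near] := choice approx.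
pose x := odd_point N (fun j => (sy j).1) (fun j => (sy j).2).
have near_x k : `|x0 0 k - ideal_point R x 0 k| <= N%:R^-1.
  have -> : ideal_point R x 0 k = ratr (odd_rat N (sy k).1 (sy k).2).
    by rewrite mxE mxE.
  exact: near.
have iN1 : N%:R^-1 <= 1 :> R by rewrite invf_le1 // ler1n.
pose eta : R := (2 ^ (m + m))%:R / N%:R.
have dist_x : euclidean_dist (ideal_point R x) x0 < eta.
  have e0 : 0 < eta by rewrite divr_gt0 // ltr0n expn_gt0.
  rewrite -[eta]gtr0_norm // -sqrtr_sqr ltr_sqrt ?exprn_gt0 //.
  apply: le_lt_trans (_ : \sum_(j < m + m) N%:R^-1 ^+ 2 < _).
    apply: ler_sum => j _; rewrite -real_normK ?num_real // distrC.
    by rewrite lerXn2r ?nnegrE ?invr_ge0.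
  rewrite sumr_const card_ord -[ltLHS]mulr_natl /eta exprMn ltr_pM2r; last first.
    by rewrite exprn_gt0 ?invr_gt0.
  rewrite -natrX ltr_nat; apply: leq_trans (ltn_expl _ (ltnSn 1)) _.
  by rewrite -expnM leq_exp2l // muln2 -addnn leq_addr.
have near_c j : normc (a 0 j - complexify (ideal_point R x) 0 j) <= eta.
  rewrite normc_subC -{1}(realifyK a).
  exact: le_trans (euclidean_dist_coord _ _ _) (ltW dist_x).
exists i, S, (fun j => (sy j).1), (fun j => (sy j).2), rank, weight.
split; last by rewrite /ideal_ball /= radius_mesh.
split.
  rewrite -(ler_rat R) ratr_bound ratr_nat -sum_ideal_point.
  have : \sum_j `|ideal_point R x 0 j| <= \sum_j (`|x0 0 j| + 1).
    apply: ler_sum => j _; apply: le_trans (_ : `|x0 0 j| + `|ideal_point R x 0 j - x0 0 j| <= _).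
      by rewrite -{1}(subrK (x0 0 j) (ideal_point R x 0 j)) addrC ler_normD.
    by rewrite lerD2l distrC; apply: le_trans (near_x j) iN1.
  rewrite big_split /= sumr_const card_ord; move: lt_S; rewrite /A -/x.
  by lra.
apply: cert => u v le_u le_v.
have le_pt := grid_point_bound R N_gt0 le_u le_v.
have r1 : 1 <= 4 * S%:R :> R by lra.
have le_pt4 : normc (grid_point R N S u v) <= 4 * S%:R by lra.
have near0 : normc (grid_point R N S u v - grid_point R N S u v) <= 0.
  by rewrite subrr (normc0 R).
have le_a j : normc (a 0 j) <= 4 * S%:R.
  have : normc (a 0 j) <= \sum_j normc (a 0 j).
    rewrite (bigD1 j) //= lerDl sumr_ge0 // => k _; exact: normc_ge0.
  by move: S0S; rewrite /S0; lra.
have le_K : d%:R ^+ 3 * (4 * S%:R) ^+ d.+1 * (0 + eta) <= (slack S)%:R / N%:R :> R.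
  rewrite -slackE ?gt_eqF // -/eta.
  apply: le_trans (_ : d%:R ^+ 3 * (4 * S%:R) ^+ d.+1 * (3 / N%:R + eta) <= _).
    by rewrite ler_wpM2l ?mulr_ge0 ?exprn_ge0 ?mulr_ge0 // lerD2r divr_ge0.
  by rewrite lerDl divr_ge0.
split; rewrite normc_subC; apply: le_trans le_K.
  exact: (centered_close d_ge2 r1 le_pt4 le_pt4 near0 le_a near_c).
exact: (centered_deriv_close d_ge2 r1 le_pt4 le_pt4 near0 le_a near_c).
Qed.

End Balls.

(** * Deciding whether a number codes a certificate *)

Section RationalCheck.
Variables (d : nat).
Local Notation m := d.-1.

Definition coefficient (x : 'rV[rat]_(m + m)) (j : 'I_m) : rat[i] :=
  (x 0 (lshift m j) +i* x 0 (rshift m j))%C.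

Definition rat_value x (z : rat[i]) : rat[i] :=
  z ^+ d + \sum_(j < m) coefficient x j * z ^+ j.

Definition rat_deriv x (z : rat[i]) : rat[i] :=
  z ^+ d.-1 *+ d + \sum_(j < m) coefficient x j * (z ^+ j.-1 *+ j).

Definition rat_point (N S u v : nat) : rat[i] :=
  ((u%:R / N%:R - S%:R) +i* (v%:R / N%:R - S%:R))%C.

(** Comparing squares of moduli keeps the check within the rationals. *)
Definition sqr_modulus (z : rat[i]) : rat := complex.Re z ^+ 2 + complex.Im z ^+ 2.

Definition trap_check (k : rat) S (r : nat) (w : rat[i]) : bool :=
  (r == 1%N) ==> ((k <= S%:R) && (sqr_modulus w <= (S%:R - k) ^+ 2)).

Definition transition_check (k : rat) (r r' w w' : nat) (z z' dz : rat[i]) :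
    bool :=
  (sqr_modulus (z - z') <= k ^+ 2) ==>
  [&& (1 < r)%N ==> (1 < r')%N && (r' < r)%N, (r == 1%N) ==> (r' == 1%N) &
    (r == 0%N) ==> ((r' == 0%N) ==>
      ((w.+2%:R + w'.+1%:R * k) ^+ 2 <= sqr_modulus dz * w'.+1%:R ^+ 2))].

Definition ball_check (i S : nat) (rank weight : nat -> nat -> nat)
    (x : 'rV[rat]_(m + m)) : bool :=
  let N := mesh d i in
  let k := (slack d S)%:R / N%:R in
  let P u v := rat_value x (rat_point N S u v) in
  let D u v := rat_deriv x (rat_point N S u v) in
  let range := iota 0 (2 * S * N).+1 in
  [&& 2 + m%:R + \sum_j `|x 0 j| <= S%:R,
    all (fun u => all (fun v => trap_check k S (rank u v) (P u v)) range) range &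
    all (fun u => all (fun v => all (fun u' => all (fun v' =>
      transition_check k (rank u v) (rank u' v') (weight u v) (weight u' v')
        (P u v) (rat_point N S u' v') (D u v)) range) range) range) range].

Section Embedding.
Variable R : realType.
Local Notation C := R[i].

Definition embed (z : rat[i]) : C :=
  (ratr (complex.Re z) +i* ratr (complex.Im z))%C.

Lemma embed_is_zmod_morphism : zmod_morphism embed.
Proof.
move=> [a b] [a' b'].
change ((ratr (a - a') +i* ratr (b - b'))%C =
  ((ratr a - ratr a') +i* (ratr b - ratr b'))%C :> C).
by rewrite !rmorphB.
Qed.

Lemma embed_is_monoid_morphism : monoid_morphism embed.
Proof.
split=> [|[a b] [a' b']]; first by rewrite /embed /= rmorph1 rmorph0.
change ((ratr (a * a' - b * b') +i* ratr (a * b' + b * a'))%C =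
  ((ratr a * ratr a' - ratr b * ratr b') +i*
   (ratr a * ratr b' + ratr b * ratr a'))%C :> C).
by rewrite rmorphB rmorphD !rmorphM.
Qed.

HB.instance Definition _ :=
  GRing.isZmodMorphism.Build rat[i] C embed embed_is_zmod_morphism.
HB.instance Definition _ :=
  GRing.isMonoidMorphism.Build rat[i] C embed embed_is_monoid_morphism.

Lemma embed_point N S u v : embed (rat_point N S u v) = grid_point R N S u v.
Proof.
by rewrite /embed /rat_point /= !rmorphB !fmorph_div /= !ratr_nat.
Qed.

Lemma embed_coefficient x j :
  embed (coefficient x j) = complexify (ideal_point R x) 0 j.
Proof. by rewrite !mxE. Qed.

Lemma embed_value x z : embed (rat_value x z) =
  (centered_poly (complexify (ideal_point R x))).[embed z].
Proof.
rewrite horner_centered rmorphD rmorphXn rmorph_sum; congr (_ + _).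
by apply: eq_bigr => j _; rewrite rmorphM rmorphXn /= embed_coefficient.
Qed.

Lemma embed_deriv x z : embed (rat_deriv x z) =
  (centered_poly (complexify (ideal_point R x)))^`().[embed z].
Proof.
rewrite horner_deriv_centered rmorphD rmorphMn rmorphXn rmorph_sum; congr (_ + _).
by apply: eq_bigr => j _; rewrite rmorphM rmorphMn rmorphXn /= embed_coefficient.
Qed.

Lemma sqr_normc_embed z : normc (embed z) ^+ 2 = ratr (sqr_modulus z).
Proof. by rewrite normc_sqr /= rmorphD !rmorphXn. Qed.

Lemma normc_embed_le z (t : rat) :
  normc (embed z) <= ratr t <-> 0 <= t /\ sqr_modulus z <= t ^+ 2.
Proof.
have sqE : 0 <= t -> (normc (embed z) <= ratr t) = (sqr_modulus z <= t ^+ 2).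
  move=> t0; rewrite -(ler_pXn2r (ltn0Sn 1)) ?nnegrE ?normc_ge0 ?ler0q //.
  set t2 := ratr t ^+ 2; set z2 := normc _ ^+ 2.
  have -> : z2 = ratr (sqr_modulus z) by apply: sqr_normc_embed.
  by rewrite /t2 -rmorphXn ler_rat.
split=> [le_t|[t0]]; last by rewrite sqE.
have t0 : 0 <= t by rewrite -(ler0q R); apply: le_trans (normc_ge0 _) le_t.
by rewrite -sqE.
Qed.

Lemma normc_embed_ge z (s t : rat) : 0 <= s -> 0 <= t ->
  (ratr s <= normc (embed z) * ratr t) = (s ^+ 2 <= sqr_modulus z * t ^+ 2).
Proof.
move=> s0 t0; have s0' : 0 <= ratr s :> R by rewrite ler0q.
have t0' : 0 <= normc (embed z) * ratr t.
  by apply: mulr_ge0; rewrite ?normc_ge0 // ler0q.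
rewrite -(ler_pXn2r (ltn0Sn 1)) ?nnegrE //.
rewrite [(normc _ * _) ^+ 2]exprMn; set z2 := normc _ ^+ 2.
have -> : z2 = ratr (sqr_modulus z) by apply: sqr_normc_embed.
by rewrite -!rmorphXn -rmorphM ler_rat.
Qed.

Lemma trap_checkP k S r w : trap_check k S r w <->
  (r = 1%N -> normc (embed w) + ratr k <= S%:R).
Proof.
have E : (normc (embed w) + ratr k <= S%:R) =
    (normc (embed w) <= ratr (S%:R - k)) by rewrite rmorphB /= ratr_nat lerBrDr.
rewrite E; split=> [/implyP H /eqP /H /andP[le_k le_w]|H].
  by apply/normc_embed_le; rewrite subr_ge0.
apply/implyP => /eqP /H /normc_embed_le [].
by rewrite subr_ge0 => -> ->.
Qed.

Lemma transition_checkP k r r' w w' z z' dz : 0 <= k ->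
  transition_check k r r' w w' z z' dz <->
  (normc (embed z - embed z') <= ratr k ->
   [/\ (1 < r)%N -> (1 < r' < r)%N, r = 1%N -> r' = 1%N &
     r = 0%N -> r' = 0%N ->
     w.+2%:R + w'.+1%:R * ratr k <= normc (embed dz) * w'.+1%:R]).
Proof.
move=> k0; rewrite -rmorphB.
have E : (w.+2%:R + w'.+1%:R * ratr k <= normc (embed dz) * w'.+1%:R) =
   ((w.+2%:R + w'.+1%:R * k) ^+ 2 <= sqr_modulus dz * w'.+1%:R ^+ 2).
  have s0 : 0 <= w.+2%:R + w'.+1%:R * k by rewrite addr_ge0 // mulr_ge0.
  rewrite -(normc_embed_ge _ s0 (ler0n _ _)).
  by rewrite rmorphD rmorphM /= !ratr_nat.
rewrite E; split=> [/implyP H /normc_embed_le [_ /H /and3P[H1 H2 H3]]|H].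
  split; first exact: (implyP H1).
    by move=> /eqP r1; apply/eqP; apply: (implyP H2).
  move=> /eqP r0 /eqP r0'; exact: (implyP (implyP H3 r0) r0').
apply/implyP => le_k; have [H1 H2 H3] := H ((normc_embed_le _ _).2 (conj k0 le_k)).
apply/and3P; split; first exact/implyP.
  by apply/implyP => /eqP r1; apply/eqP; apply: H2.
by apply/implyP => /eqP r0; apply/implyP => /eqP r0'; apply: H3.
Qed.

Lemma all_iotaP (P : nat -> bool) n :
  all P (iota 0 n.+1) <-> forall u, (u <= n)%N -> P u.
Proof.
split=> [/allP H u le_u|H]; first by apply: H; rewrite mem_iota.
by apply/allP => u; rewrite mem_iota => /andP[_]; apply: H.
Qed.

Lemma ball_checkP i S rank weight x :
  ball_check i S rank weight x <-> valid_ball R i S rank weight x.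
Proof.
rewrite /ball_check /valid_ball /certificate.
set N := mesh d i; set side := (2 * S * N)%N; set p := centered_poly _.
set k := _ / _.
have k0 : 0 <= k by rewrite divr_ge0.
have -> : (slack d S)%:R / N%:R = ratr k :> R by rewrite fmorph_div /= !ratr_nat.
split.
  case/and3P => bound /all_iotaP trap /all_iotaP trans; do 2!split=> //.
    move=> u v le_u le_v; have /all_iotaP/(_ v le_v)/trap_checkP := trap u le_u.
    by rewrite embed_value embed_point.
  move=> u v u' v' le_u le_v le_u' le_v'.
  have /all_iotaP/(_ v le_v)/all_iotaP/(_ u' le_u')/all_iotaP/(_ v' le_v') :=
    trans u le_u.
  by move/(transition_checkP _ _ _ _ _ _ _ k0); rewrite embed_deriv embed_value !embed_point.
case=> bound [trap trans]; apply/and3P; split=> //.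
  apply/all_iotaP => u le_u; apply/all_iotaP => v le_v; apply/trap_checkP.
  by rewrite embed_value embed_point; apply: trap.
apply/all_iotaP => u le_u; apply/all_iotaP => v le_v.
apply/all_iotaP => u' le_u'; apply/all_iotaP => v' le_v'.
apply/(transition_checkP _ _ _ _ _ _ _ k0).
by rewrite embed_deriv embed_value !embed_point; apply: trans.
Qed.

End Embedding.
End RationalCheck.

Section Decidability.
Variable d : nat.
Local Notation m := d.-1.

Lemma computable_mesh k (f : env k -> nat) :
  computable f -> computable (fun e => mesh d (f e)).
Proof.
move=> Cf; apply: computable_exp2; apply: computable_add => //.
exact: computable_const.
Qed.

Lemma computable_slack k (f : env k -> nat) :
  computable f -> computable (fun e => slack d (f e)).
Proof.
move=> Cf; apply: computable_add; last exact: computable_const.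
apply: computable_mul; last exact: computable_const.
apply: computable_mul; first exact: computable_const.
by apply: computable_expn; apply: computable_mul => //; apply: computable_const.
Qed.

Lemma rational_div k (f g : env k -> nat) : computable f -> computable g ->
  rational_computable (fun e => (f e)%:R / (g e)%:R).
Proof.
by move=> Cf Cg; apply: rational_mul; [exact: rational_nat | exact: rational_inv].
Qed.

Lemma computable_odd k (y : env k -> nat) :
  computable y -> computable (fun e => ((y e).*2.+1)%N).
Proof.
move=> Cy; apply: computable_succ.
by apply: (computable_ext (f := fun e => (y e + y e)%N));
  [move=> e; rewrite addnn | exact: computable_add].
Qed.

Lemma decidable_pos k (f : env k -> nat) :
  computable f -> decidable_on (fun e => (0 < f e)%N).
Proof. by move=> Cf; apply: decidable_leq => //; apply: computable_const. Qed.

Lemma rational_odd_rat k (N sg y : env k -> nat) :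
  computable N -> computable sg -> computable y ->
  rational_computable (fun e => odd_rat (N e) (sg e) (y e)).
Proof.
move=> CN Cs Cy.
have Csign : rational_computable (fun e => (-1) ^+ (0 < sg e)%N : rat).
  apply: (rational_ext (f := fun e => 1%:R - (2 * (0 < sg e))%N%:R)).
    by move=> e; case: (0 < sg e)%N.
  apply: rational_sub; apply: rational_nat; first exact: computable_const.
  by apply: computable_mul; [exact: computable_const | exact: decidable_pos].
apply: rational_ext (rational_mul Csign (rational_div (computable_odd Cy) CN)) => e.
by rewrite mulrA.
Qed.

Lemma normr_odd_rat N sg y : `|odd_rat N sg y| = (y.*2.+1)%:R / N%:R.
Proof.
by rewrite /odd_rat !normrM normrX normrN1 expr1n mul1r normfV !normr_nat.
Qed.

Lemma rational_sqr_modulus k (z : env k -> rat[i]) : complex_computable z ->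
  rational_computable (fun e => sqr_modulus (z e)).
Proof. by case=> C1 C2; apply: rational_add; apply: rational_mul. Qed.

Lemma complex_rat_point k (N S u v : env k -> nat) :
  computable N -> computable S -> computable u -> computable v ->
  complex_computable (fun e => rat_point (N e) (S e) (u e) (v e)).
Proof.
move=> CN CS Cu Cv; apply: complex_make.
  by apply: rational_sub; [exact: rational_div | exact: rational_nat].
by apply: rational_sub; [exact: rational_div | exact: rational_nat].
Qed.

Lemma complex_coefficient k (x : env k -> 'rV[rat]_(m + m)) j :
  (forall j, rational_computable (fun e => x e 0 j)) ->
  complex_computable (fun e => coefficient (x e) j).
Proof. by move=> Cx; apply: complex_make. Qed.

Lemma complex_rat_value k (x : env k -> 'rV[rat]_(m + m)) (z : env k -> rat[i]) :
  (forall j, rational_computable (fun e => x e 0 j)) -> complex_computable z ->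
  complex_computable (fun e => rat_value (x e) (z e)).
Proof.
move=> Cx Cz; apply: complex_add; first exact: complex_exp.
apply: complex_sum => j; apply: complex_mul; first exact: complex_coefficient.
exact: complex_exp.
Qed.

Lemma complex_rat_deriv k (x : env k -> 'rV[rat]_(m + m)) (z : env k -> rat[i]) :
  (forall j, rational_computable (fun e => x e 0 j)) -> complex_computable z ->
  complex_computable (fun e => rat_deriv (x e) (z e)).
Proof.
move=> Cx Cz; apply: complex_add.
  by apply: complex_muln; apply: complex_exp.
apply: complex_sum => j; apply: complex_mul; first exact: complex_coefficient.
by apply: complex_muln; apply: complex_exp.
Qed.

Lemma decidable_trap_check k (q : env k -> rat) (S r : env k -> nat) w :
  rational_computable q -> computable S -> computable r ->
  complex_computable w ->
  decidable_on (fun e => trap_check (q e) (S e) (r e) (w e)).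
Proof.
move=> Cq CS Cr Cw; apply: decidable_imply.
  by apply: decidable_eq => //; apply: computable_const.
have CSq := rational_nat CS.
apply: decidable_and; apply: decidable_le_rational => //.
  exact: rational_sqr_modulus.
by apply: rational_mul; apply: rational_sub.
Qed.

Lemma decidable_transition_check k (q : env k -> rat)
    (r r' w w' : env k -> nat) (z z' dz : env k -> rat[i]) :
  rational_computable q -> computable r -> computable r' -> computable w ->
  computable w' -> complex_computable z -> complex_computable z' ->
  complex_computable dz ->
  decidable_on (fun e =>
    transition_check (q e) (r e) (r' e) (w e) (w' e) (z e) (z' e) (dz e)).
Proof.
move=> Cq Cr Cr' Cw Cw' Cz Cz' Cdz.
have C0 := @computable_const k 0; have C1 := @computable_const k 1.
have C2 := @computable_const k 2.
have Cw1 := rational_nat (computable_succ Cw').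
have Cw2 := rational_nat (computable_succ (computable_succ Cw)).
apply: decidable_imply.
  apply: decidable_le_rational; last exact: rational_mul.
  by apply: rational_sqr_modulus; apply: complex_add => //; apply: complex_opp.
apply: decidable_and.
  apply: decidable_imply; first exact: decidable_leq.
  apply: decidable_and; first exact: decidable_leq.
  by apply: decidable_leq => //; apply: computable_succ.
apply: decidable_and.
  by apply: decidable_imply; apply: decidable_eq.
apply: decidable_imply; first exact: decidable_eq.
apply: decidable_imply; first exact: decidable_eq.
apply: decidable_le_rational.
  by apply: rational_mul; apply: rational_add => //; apply: rational_mul.
apply: rational_mul; first exact: rational_sqr_modulus.
exact: rational_mul.
Qed.

(** A code lists the exponent of the radius, the size of the square, the tables
of ranks and weights, and the signs and numerators of the centre. *)
Definition rank_of (n u v : nat) : nat := entry (entry (entry n 2) u) v.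
Definition weight_of (n u v : nat) : nat := entry (entry (entry n 3) u) v.
Definition center_of (n : nat) : 'rV[rat]_(m + m) :=
  odd_point d (mesh d (entry n 0)) (entry (entry n 4)) (entry (entry n 5)).

Definition code_check (n : nat) : bool :=
  ball_check (entry n 0) (entry n 1) (rank_of n) (weight_of n) (center_of n).

Lemma computable_field k (f : env k -> nat) c :
  computable f -> computable (fun e => entry (f e) c).
Proof. by move=> Cf; apply: computable_entry => //; apply: computable_const. Qed.

Lemma computable_table k (f u v : env k -> nat) c :
  computable f -> computable u -> computable v ->
  computable (fun e => entry (entry (entry (f e) c) (u e)) (v e)).
Proof.
by move=> Cf Cu Cv; do 2!apply: computable_entry => //; apply: computable_field.
Qed.

Lemma rational_center k (f : env k -> nat) j : computable f ->
  rational_computable (fun e => center_of (f e) 0 j).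
Proof.
move=> Cf; apply: (rational_ext (f := fun e => odd_rat (mesh d (entry (f e) 0))
  (entry (entry (f e) 4) j) (entry (entry (f e) 5) j))).
  by move=> e; rewrite mxE.
apply: rational_odd_rat; first by apply: computable_mesh; apply: computable_field.
  by do 2!apply: computable_field.
by do 2!apply: computable_field.
Qed.

Lemma decidable_code_check : decidable_on (fun e : env 1 => code_check e.2).
Proof.
have Cn : computable (fun e : env 1 => e.2) := @computable_last 0.
have Crange k (f : env k -> nat) : computable f ->
    computable (fun e => (2 * entry (f e) 1 * mesh d (entry (f e) 0)).+1).
  move=> Cf; apply: computable_succ; apply: computable_mul.
    by apply: computable_mul; [exact: computable_const | exact: computable_field].
  by apply: computable_mesh; apply: computable_field.
have Ck k (f : env k -> nat) : computable f ->
    rational_computable (fun e =>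
      (slack d (entry (f e) 1))%:R / (mesh d (entry (f e) 0))%:R).
  move=> Cf; apply: rational_div.
    by apply: computable_slack; apply: computable_field.
  by apply: computable_mesh; apply: computable_field.
have Cpt k (f u v : env k -> nat) : computable f -> computable u -> computable v ->
    complex_computable (fun e =>
      rat_point (mesh d (entry (f e) 0)) (entry (f e) 1) (u e) (v e)).
  move=> Cf Cu Cv; apply: complex_rat_point => //; last exact: computable_field.
  by apply: computable_mesh; apply: computable_field.
apply: decidable_and; last apply: decidable_and.
- apply: decidable_le_rational; last by apply: rational_nat; apply: computable_field.
  apply: (rational_ext (f := fun e : env 1 => (2 + m)%N%:R + \sum_(j < m + m)
      (entry (entry e.2 5) j).*2.+1%:R / (mesh d (entry e.2 0))%:R)).
    move=> e; rewrite natrD; congr (_ + _); apply: eq_bigr => j _.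
    by rewrite mxE normr_odd_rat.
  apply: rational_add; first by apply: rational_nat; apply: computable_const.
  apply: rational_sum => j; apply: rational_div.
    by apply: computable_odd; do 2!apply: computable_field.
  by apply: computable_mesh; apply: computable_field.
- apply: decidable_all; first exact: Crange.
  apply: decidable_all; first exact: (Crange _ _ (computable_weaken Cn)).
  have Cn3 : computable (fun e : env 3 => e.1.1.2).
    exact: (computable_weaken (computable_weaken Cn)).
  have Cu : computable (fun e : env 3 => e.1.2).
    exact: (computable_weaken (@computable_last 1)).
  have Cv : computable (fun e : env 3 => e.2) := @computable_last 2.
  apply: (@decidable_trap_check 3).
  + exact: Ck.
  + exact: computable_field.
  + exact: computable_table.
  + by apply: complex_rat_value => [j|]; [apply: rational_center | apply: Cpt].
apply: decidable_all; first exact: Crange.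
apply: decidable_all; first exact: (Crange _ _ (computable_weaken Cn)).
apply: decidable_all.
  exact: (Crange _ _ (computable_weaken (computable_weaken Cn))).
apply: decidable_all.
  exact: (Crange _ _ (computable_weaken (computable_weaken (computable_weaken Cn)))).
have Cn5 : computable (fun e : env 5 => e.1.1.1.1.2).
  exact: (computable_weaken (computable_weaken (computable_weaken (computable_weaken Cn)))).
have Cu : computable (fun e : env 5 => e.1.1.1.2).
  exact: (computable_weaken (computable_weaken (computable_weaken (@computable_last 1)))).
have Cv : computable (fun e : env 5 => e.1.1.2).
  exact: (computable_weaken (computable_weaken (@computable_last 2))).
have Cu' : computable (fun e : env 5 => e.1.2).
  exact: (computable_weaken (@computable_last 3)).
have Cv' : computable (fun e : env 5 => e.2) := @computable_last 4.
apply: (@decidable_transition_check 5).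
- exact: Ck.
- exact: computable_table.
- exact: computable_table.
- exact: computable_table.
- exact: computable_table.
- by apply: complex_rat_value => [j|]; [apply: rational_center | apply: Cpt].
- exact: Cpt.
- by apply: complex_rat_deriv => [j|]; [apply: rational_center | apply: Cpt].
Qed.

End Decidability.

(** * Enumeration of the locus *)

Section PowerMap.
Variables (R : realType) (d : nat).
Local Notation C := R[i].
Hypothesis d_ge2 : (2 <= d)%N.

Lemma orbit_power n (z : C) : orbit 'X^d n z = z ^+ (d ^ n).
Proof.
elim: n => [|n IH]; first by rewrite expn0 expr1.
by rewrite -[LHS]/('X^d).[orbit 'X^d n z] hornerXn IH -exprM -expnSr.
Qed.

(** Inside the unit circle all orbits are bounded, outside they are not. *)
Lemma julia_power (z : C) : julia 'X^d z -> normc z = 1.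
Proof.
move/juliaP => [bounded unbounded]; case: (ltrgtP (normc z) 1) => // lt_z.
  have e0 : 0 < 1 - normc z by lra.
  have [w lt_w nb] := unbounded _ e0; case: nb; exists 1 => n.
  rewrite orbit_power normcX; apply: exprn_ile1; first exact: normc_ge0.
  by have := normc_le_add w z; lra.
have e0 : 0 < normc z - 1 by lra.
have [w lt_w [B HB]] := bounded _ e0.
have w1 : 1 < normc w.
  by have := normc_le_add z w; rewrite normc_subC; lra.
have [k le_k] := unbounded_powers (B + 1) w1.
have := HB k; rewrite orbit_power normcX => le_B.
have : normc w ^+ k <= normc w ^+ (d ^ k).
  by apply: ler_weXn2l; [lra | apply: ltnW; apply: ltn_expl].
by lra.
Qed.

Lemma hyperbolic_power : hyperbolic ('X^d : {poly C}).
Proof.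
exists 1, d%:R; split; [by [] | by rewrite ltr1n | move=> z Jz n].
rewrite horner_deriv_iterate normcE lecR mul1r.
have z1 := julia_power Jz.
rewrite /multiplier normc_prod (eq_bigr (fun=> d%:R)) => [|k _].
  by rewrite prodr_const card_ord.
rewrite derivXn hornerMn hornerXn normcMn normcX orbit_power normcX.
by rewrite [normc z]z1 !expr1n.
Qed.

Lemma centered_poly0 : centered_poly (0 : 'rV[C]_d.-1) = 'X^d.
Proof.
rewrite /centered_poly big1 ?addr0 // => j _.
by rewrite mxE scale0r.
Qed.

End PowerMap.

Section Printing.
Variable d : nat.
Local Notation m := d.-1.

(** The fraction is in lowest terms, so the numerator and the denominator of the
rational number are the given ones. *)
Lemma rat_word_odd k sg y : rat_word (odd_rat (2 ^ k) sg y) =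
  ((0 < sg)%N :: nat_word y.*2.+1) ++ (false :: nat_word (2 ^ k)).
Proof.
pose n : int := (-1) ^+ (0 < sg)%N * (y.*2.+1)%:Z.
have absn : `|n|%N = y.*2.+1.
  by rewrite /n abszM abszX abszN absz1 exp1n mul1n.
have sgn : (n < 0) = (0 < sg)%N.
  by rewrite /n; case: (0 < sg)%N; rewrite ?expr1 ?expr0 ?mulN1r ?mul1r.
have Eq : odd_rat (2 ^ k) sg y = n%:~R / (2 ^ k)%:Z%:~R.
  by rewrite /odd_rat /n rmorphM rmorphXn rmorphN1 !pmulrn.
have cop : coprime `|n| `|(2 ^ k)%:Z|.
  by rewrite absn absz_nat coprimeXr // coprimen2 /= odd_double.
have k0 : (2 ^ k)%:Z != 0 by rewrite -lt0n expn_gt0.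
rewrite /rat_word Eq coprimeq_num // coprimeq_den // (negbTE k0).
rewrite gtr0_sg ?mul1r; last by rewrite ltz_nat expn_gt0.
by rewrite /int_word sgn absn absz_nat.
Qed.

Lemma printable_odd_rat k (i sg y : env k -> nat) :
  computable i -> computable sg -> computable y ->
  printable (fun e => rat_word (odd_rat (mesh d (i e)) (sg e) (y e))).
Proof.
move=> Ci Cs Cy.
apply: (printable_ext (f := fun e =>
  (if (0 < sg e)%N then [:: true] else [:: false]) ++
  (nat_word (y e).*2.+1 ++ ([:: false] ++ nat_word (mesh d (i e)))))).
  by move=> e; rewrite rat_word_odd; case: (0 < sg e)%N.
apply: printable_cat.
  by apply: printable_if => //; apply: printable_const.
apply: printable_cat; first by apply: printable_nat_word; apply: computable_odd.
apply: printable_cat; first exact: printable_const.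
by apply: printable_nat_word; apply: computable_mesh.
Qed.

Lemma printable_code : printable (fun e : env 1 =>
  ball_word (center_of d e.2) (entry e.2 0)%:Z).
Proof.
have Cn : computable (fun e : env 1 => e.2) := @computable_last 0.
apply: printable_cat; last first.
  apply: (printable_ext (f := fun e : env 1 => [:: false] ++ nat_word (entry e.2 0))).
    by [].
  apply: printable_cat; first exact: printable_const.
  by apply: printable_nat_word; apply: computable_field.
elim: (enum _) => [|j s IH]; first exact: printable_const.
apply: printable_cat; last exact: IH.
apply: (printable_ext (f := fun e : env 1 => rat_word (odd_rat (mesh d (entry e.2 0))
  (entry (entry e.2 4) j) (entry (entry e.2 5) j)))).
  by move=> e; rewrite mxE.
by apply: printable_odd_rat; do ?apply: computable_field.
Qed.

End Printing.

Lemma valid_ball_ext (R : realType) d i S (r r' w w' : nat -> nat -> nat) x :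
  (forall u v, (u <= 2 * S * mesh d i)%N -> (v <= 2 * S * mesh d i)%N ->
     r u v = r' u v /\ w u v = w' u v) ->
  @valid_ball R d i S r w x -> @valid_ball R d i S r' w' x.
Proof.
move=> E [bound [trap trans]]; split=> //; split=> [u v le_u le_v|].
  by have [<- _] := E u v le_u le_v; apply: trap.
move=> u v u' v' le_u le_v le_u' le_v'.
have [<- <-] := E u v le_u le_v; have [<- <-] := E u' v' le_u' le_v'.
exact: trans.
Qed.

Local Open Scope classical_set_scope.

Theorem theorem1p3 (R : realType) (d : nat) (hd : (2 <= d)%N) :
  lower_semicomputable ((@realify R d.-1) @` hyperbolic_locus R d).
Proof.
(* The ball printed for numbers that code no certificate comes from z^d. *)
have hyp0 : hyperbolic (centered_poly (0 : 'rV[R[i]]_d.-1)).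
  by rewrite centered_poly0; apply: hyperbolic_power.
have [i0 [S0 [sg0 [y0 [r0 [w0 [valid0 _]]]]]]] := hyperbolic_valid_ball hd hyp0.
pose x0 := odd_point d (mesh d i0) sg0 y0.
pose x n := if code_check d n then center_of d n else x0.
pose e n := if code_check d n then entry n 0 else i0.
have [M HM] : exists M, forall n,
    tm_computes M (nat_word n) (ball_word (x n) (e n)%:Z).
  apply: printable_computes.
  apply: (printable_ext (f := fun v : env 1 => if (0 < code_check d v.2)%N then
     ball_word (center_of d v.2) (entry v.2 0)%:Z else ball_word x0 i0%:Z)).
    by move=> v; rewrite /x /e lt0b; case: (code_check d v.2).
  apply: printable_if; [exact: decidable_code_check | exact: printable_code |].
  exact: printable_const.
exists M, x, (fun n => (e n)%:Z); split=> //.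
apply/seteqP; split=> [_ [a hyp_a <-]|y [n _]]; last first.
  rewrite /x /e; case: ifP => [/(ball_checkP R) valid|_].
    by move=> near; exact (valid_ball_hyperbolic hd valid near).
  by move=> near; exact (valid_ball_hyperbolic hd valid0 near).
have [i [S [sg [y [r [w [valid near]]]]]]] := hyperbolic_valid_ball hd hyp_a.
have [tr Htr] := entry2_surjective r (2 * S * mesh d i).+1.
have [tw Htw] := entry2_surjective w (2 * S * mesh d i).+1.
have [tsg Hsg] := entry_surjective sg (d.-1 + d.-1).
have [ty Hy] := entry_surjective y (d.-1 + d.-1).
have [n Hn] := entry_surjective (nth 0%N [:: i; S; tr; tw; tsg; ty]) 6.
have center_n : center_of d n = odd_point d (mesh d i) sg y.
  apply/rowP => j; rewrite !mxE !Hn //=.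
  by rewrite Hsg ?Hy.
have check_n : code_check d n.
  apply/(ball_checkP R); rewrite center_n !Hn //=.
  apply: valid_ball_ext valid => u v le_u le_v.
  by rewrite /rank_of /weight_of !Hn //= Htr ?Htw.
exists n => //; rewrite /x /e check_n center_n Hn //.
Qed.
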